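(* Let $\mathcal H$ be a separable Hilbert space, let $A$ and $K$ be bounded self-adjoint operators on $\mathcal H$, and let $K=K_+-K_-$ be the spectral decomposition of $K$ into its positive and negative parts, $K_\pm=\pm K\,\mathbf E_K(\mathbb R_\pm)$, where $\mathbf E_K$ is the projection-valued spectral measure of $K$ and $\mathbb R_+=(0,\infty)$, $\mathbb R_-=(-\infty,0)$. Let $\sigma$ be an arbitrary singular measure on $\mathbb R$. If $\operatorname{Ran} K$ is cyclic for $A$, then the spectral measure of the operator $$A_{\vec t}=A+t_1K_++t_2K_-,\qquad \vec t=(t_1,t_2)\in\mathbb R^2,$$ is mutually singular with $\sigma$ for (Lebesgue) almost all $\vec t\in\mathbb R^2$.
   Context: Measures on $\mathbb R$ are finite non-negative Borel measures; ''singular'' means singular with respect to Lebesgue measure. Operators are bounded. For a self-adjoint operator $A$ on $\mathcal H$ with projection-valued spectral measure $\mathbf E$, the scalar spectral measure of $\mathbf x\in\mathcal H$ is $\mu_{\mathbf x}(\cdot)=\langle \mathbf E(\cdot)\mathbf x,\mathbf x\rangle$. A vector $\mathbf x$ has maximal spectral type if $\mu_{\mathbf y}\ll\mu_{\mathbf x}$ for every $\mathbf y\in\mathcal H$. ''The spectral measure of $A$'' means a scalar spectral measure of maximal spectral type, i.e. $\mu_{\mathbf x}$ for some $\mathbf x$ of maximal spectral type; it is unique up to mutual absolute continuity. A set $S\subset\mathcal H$ is cyclic for $A$ if the smallest closed $A$-invariant subspace containing $S$ is $\mathcal H$. *)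

(* Defs.v *)
From HB Require Import structures.
From mathcomp Require Import all_boot all_order all_algebra sesquilinear.
From mathcomp Require Import complex.
From mathcomp Require Import all_classical all_reals all_analysis.

Set Implicit Arguments.
Unset Strict Implicit.
Unset Printing Implicit Defensive.

Import Order.TTheory GRing.Theory Num.Theory.
Import numFieldNormedType.Exports.

Local Open Scope classical_set_scope.
Local Open Scope ring_scope.
Local Open Scope complex_scope.

(* The inner product is linear in its first argument and conjugate-linear in
   the second. *)
Record hilbertType (R : realType) := HilbertType {
  hilbert_sort :> completeNormedModType R[i];
  inner : {dot hilbert_sort for Num.conj};
  inner_norm : forall x : hilbert_sort, `|x| ^+ 2 = inner x x }.

Arguments inner {R h} : rename.

Section operators.
Context (R : realType) (H : hilbertType R).

Definition separable := exists D : set H, countable D /\ dense D.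

Definition self_adjoint (A : H -> H) :=
  forall x y : H, inner (A x) y = inner x (A y).

(* For a linear map this is the usual boundedness, see [linear_boundedP]. *)
Definition bounded_op (A : H -> H) := bounded_near A (nbhs (0 : H)).

Definition closed_invariant_subspace (A : H -> H) (M : set H) :=
  [/\ closed M, M 0,
      forall (a : R[i]) (u v : H), M u -> M v -> M (a *: u + v) &
      forall u, M u -> M (A u)].

Definition cyclic_for (A : H -> H) (S : set H) :=
  smallest (closed_invariant_subspace A) S = [set: H].

(* Projection-valued Borel measures on the line; only the values on Borel sets
   are constrained. *)
Record pvm := PVM {
  pvm_op :> set (measurableTypeR R) -> {linear H -> H};
  pvm_idem : forall B, measurable B ->
    forall x, pvm_op B (pvm_op B x) = pvm_op B x;
  pvm_self_adjoint : forall B, measurable B -> self_adjoint (pvm_op B);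
  pvm_set0 : forall x, pvm_op set0 x = 0;
  pvm_setT : forall x, pvm_op setT x = x;
  pvm_setI : forall B C, measurable B -> measurable C ->
    forall x, pvm_op (B `&` C) x = pvm_op B (pvm_op C x);
  pvm_sigma_additive : forall F : nat -> set (measurableTypeR R),
    (forall n, measurable (F n)) -> trivIset setT F ->
    forall x, (fun n => \sum_(0 <= i < n) pvm_op (F i) x) @ \oo -->
      pvm_op (\bigcup_n F n) x }.

(* The scalar measure mu_x(B) = <E(B) x, x>, a real number since E(B) is
   self-adjoint.  Library measures are functions on all sets, nonnegative even
   off the sigma-algebra; whence the value 0 at non-Borel sets. *)
Definition scalar_measure (E : pvm) (x : H) (B : set (measurableTypeR R)) : \bar R :=
  if `[< measurable B >] then (complex.Re (inner (E B x) x))%:E else 0%E.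

End operators.

Section scalar_measure_is_measure.
Context (R : realType) (H : hilbertType R) (E : pvm H) (x : H).

Let mu := scalar_measure E x.

Let muE B : measurable B -> mu B = (complex.Re (inner (E B x) x))%:E.
Proof. by move=> mB; rewrite /mu /scalar_measure asboolT. Qed.

Let mu0 : mu set0 = 0%E.
Proof. by rewrite muE ?pvm_set0 ?linear0l. Qed.

Let mu_ge0 B : (0 <= mu B)%E.
Proof.
rewrite /mu /scalar_measure; case: asboolP => // mB; rewrite lee_fin.
rewrite -(pvm_idem E mB) pvm_self_adjoint//.
by have := dnorm_ge0 inner (E B x); rewrite lecE => /andP[].
Qed.

Let Re_inner (u v : H) :
  complex.Re (inner u v) = complex.Re (`|u| ^+ 2 + `|v| ^+ 2 - `|u - v| ^+ 2) / 2.
Proof.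
rewrite !inner_norm dnormB /= opprB addrC subrK.
rewrite -[Num.conj _]/(conjc _); case: (inner u v) => a b /=.
by rewrite -mulr2n -(mulr_natr a) mulfK ?pnatr_eq0.
Qed.

Let ReD (a b : R[i]) : complex.Re (a + b) = complex.Re a + complex.Re b.
Proof. by case: a; case: b. Qed.

Let cvg_Re (f : nat -> R[i]^o) (l : R[i]^o) :
  f @ \oo --> l -> complex.Re (f n) @[n --> \oo] --> complex.Re l.
Proof.
move=> fl; apply/cvgrPdist_lt => e e0.
have e0' : 0 < e%:C by rewrite ltcR.
move/cvgrPdist_lt : fl => /(_ _ e0'); apply: filterS => n.
rewrite -ltcR; apply: le_lt_trans.
by have := normc_ge_Re (l - f n); case: (l) => a b; case: (f n) => c d.
Qed.

Let mu_sigma_additive : semi_sigma_additive mu.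
Proof.
move=> F mF tF mUF; rewrite muE//.
rewrite (_ : (fun n => _) = EFin \o
    (fun n => complex.Re (inner (\sum_(0 <= i < n) E (F i) x) x))); last first.
  apply/funext => n /=; rewrite linear_sumlz.
  rewrite (big_morph _ ReD (erefl : complex.Re (0 : R[i]) = 0)) -sumEFin.
  by apply: eq_bigr => i _; rewrite muE.
apply: cvg_EFin; first exact: nearW.
under eq_fun do rewrite /= Re_inner.
rewrite Re_inner; apply: cvgMl; apply: cvg_Re.
have h := @pvm_sigma_additive _ _ E F mF tF x.
apply: cvgB.
  apply: cvgD; last exact: cvg_cst.
  by apply: cvgM; exact: (cvg_norm h).
have h' : (\sum_(0 <= i < n) E (F i) x - x) @[n --> \oo] -->
    E (\bigcup_n F n) x - x by apply: cvgB => //; exact: cvg_cst.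
by apply: cvgM; exact: (cvg_norm h').
Qed.

HB.instance Definition _ := isMeasure.Build _ _ _ (scalar_measure E x)
  mu0 mu_ge0 mu_sigma_additive.

Let mu_fin : fin_num_fun mu.
Proof. by move=> B mB; rewrite muE. Qed.

HB.instance Definition _ := @Measure_isFinite.Build _ _ _ (scalar_measure E x)
  mu_fin.

End scalar_measure_is_measure.

Section spectral.
Context (R : realType) (H : hilbertType R).

(* [E] is the spectral measure of the bounded self-adjoint operator [A], that
   is A = \int l dE(l) in the weak sense; by polarization it suffices to give
   the quadratic form of the integral. *)
Definition spectral_pvm (A : H -> H) (E : pvm H) := forall x : H,
  (scalar_measure E x).-integrable setT (EFin : R -> \bar R) /\
  inner (A x) x = (\int[scalar_measure E x]_(l in setT) l)%:C.

Definition maximal_spectral_type (E : pvm H) (x : H) :=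
  forall y : H, scalar_measure E y `<< scalar_measure E x.

(* This determines [mu] up to mutual absolute continuity only. *)
Definition is_spectral_measure (A : H -> H) (mu : {measure set (measurableTypeR R) -> \bar R}) :=
  exists (E : pvm H) (x : H), [/\ spectral_pvm A E, maximal_spectral_type E x &
    forall B, measurable B -> mu B = scalar_measure E x B].

Definition positive_part (K : H -> H) (EK : pvm H) (x : H) : H :=
  K (EK `]0, +oo[%classic x).

Definition negative_part (K : H -> H) (EK : pvm H) (x : H) : H :=
  - K (EK `]-oo, 0[%classic x).

End spectral.

Definition mutually_singular d (T : measurableType d) (R : realType)
    (mu nu : {measure set T -> \bar R}) :=
  exists N : set T, [/\ measurable N, mu N = 0%E & nu (~` N) = 0%E].

(* Main.v *)
(* For L >= 0 and t real, the resolvent of A + t L satisfies a spectral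
   averaging estimate: if I is an interval of length |I| then
     \int <E_t(I) L y, L y> dt <= 2 pi <L y, y> |I|,
   so that a Lebesgue null set B has E_t(B) L y = 0 for almost every t.
   To prove it, let z = c + i e be the midpoint plus i times the half-length
   of I, P = A - z - i L and w = (1 - i t)/(1 + i t).  Then
   (1 + w) (A + t L - z) = P + w (P + 2 i L).  Expanding the inverse in powers
   of -w gives coefficients u_n = P^-1 L y_n, with y_{n+1} = y_n + 2 i u_n and
   y_0 = y, for which
     <L y_{n+1}, y_{n+1}> = <L y_n, y_n> - 4 e |u_n|^2.
   Hence \sum 4 e |u_n|^2 <= <L y, y>, and Parseval's identity on the circle
   |w| = 1 bounds the integral of |(A + t L - z)^-1 L y|^2.  Cesaro means
   replace the series, which need not converge for |w| = 1; all quantities are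
   then measurable in the couplings, whatever the projections E_t are.
   Averaging over t_1 with L = K_+ and over t_2 with L = K_-, and using Fubini,
   E_t(B) vanishes on Ran K for almost every t.  As its kernel is closed and
   A-invariant, it is everything when Ran K is cyclic. *)
Require Import Defs.
From HB Require Import structures.
From mathcomp Require Import all_boot all_order all_algebra sesquilinear.
From mathcomp Require Import complex.
From mathcomp Require Import all_classical all_reals all_analysis.
From mathcomp Require Import measurable_realfun ring lra.

Set Implicit Arguments.
Unset Strict Implicit.
Unset Printing Implicit Defensive.

Import Order.TTheory GRing.Theory Num.Theory.
Import numFieldNormedType.Exports.

Local Open Scope classical_set_scope.
Local Open Scope ring_scope.
Local Open Scope complex_scope.

(** * The real part of the inner product as a real bilinear form *)

Section real_inner_product.
Context (R : realType) (H : hilbertType R).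
Implicit Types (x y z : H) (r : R) (a : R[i]).

(** A symmetric real bilinear form, within reach of [ring] and [lra]; the imaginary part of
    [inner x y] survives as [ip x ('i *: y)]. *)
Definition ip x y : R := complex.Re (inner x y).
(** The norm of [H] takes values in [R[i]]; by [normE] its real part loses nothing. *)
Definition hnorm x : R := complex.Re `|x|.

Lemma Re_add (a b : R[i]) : complex.Re (a + b) = complex.Re a + complex.Re b.
Proof. by case: a; case: b. Qed.

Lemma Re_opp (a : R[i]) : complex.Re (- a) = - complex.Re a.
Proof. by case: a. Qed.

Lemma ipDl x y z : ip (x + y) z = ip x z + ip y z.
Proof. by rewrite /ip linearDl Re_add. Qed.

Lemma ipDr x y z : ip z (x + y) = ip z x + ip z y.
Proof. by rewrite /ip linearD Re_add. Qed.

Lemma ipNl x y : ip (- x) y = - ip x y.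
Proof. by rewrite /ip linearNl Re_opp. Qed.

Lemma ipNr x y : ip x (- y) = - ip x y.
Proof. by rewrite /ip linearN Re_opp. Qed.

Lemma ip0l x : ip 0 x = 0.
Proof. by rewrite /ip linear0l. Qed.

Lemma ip0r x : ip x 0 = 0.
Proof. by rewrite /ip linear0. Qed.

Lemma ipZl r x y : ip (r%:C *: x) y = r * ip x y.
Proof.
rewrite /ip linearZl_LR /=; case: (inner x y) => u v /=.
by rewrite mul0r subr0.
Qed.

Lemma ipZr r x y : ip x (r%:C *: y) = r * ip x y.
Proof.
rewrite /ip linearZr_LR /=; case: (inner x y) => u v /=.
by rewrite oppr0 mul0r subr0.
Qed.

Lemma inner_conj x y : inner y x = conjc (inner x y).
Proof. by rewrite hermC /= mul1r. Qed.

Lemma ipC x y : ip x y = ip y x.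
Proof. by rewrite /ip (inner_conj y x); case: (inner y x). Qed.

Lemma ip_il x y : ip ('i *: x) y = - complex.Im (inner x y).
Proof.
rewrite /ip linearZl_LR /=; case: (inner x y) => u v /=.
by rewrite mul0r mul1r sub0r.
Qed.

Lemma ip_ir x y : ip x ('i *: y) = complex.Im (inner x y).
Proof.
rewrite /ip linearZr_LR /=; case: (inner x y) => u v /=.
by rewrite mul0r mulN1r opprK add0r.
Qed.

Lemma ip_Ni x y : ip ('i *: x) y = - ip x ('i *: y).
Proof. by rewrite ip_il ip_ir. Qed.

Lemma ip_ii x y : ip ('i *: x) ('i *: y) = ip x y.
Proof.
by rewrite ip_Ni scalerA -expr2 sqr_i scaleN1r ipNr opprK.
Qed.

Lemma ip_i_diag x : ip ('i *: x) x = 0.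
Proof. by have := ip_Ni x x; rewrite (ipC x) => h; lra. Qed.

Lemma ipZc a x y :
  ip (a *: x) y = complex.Re a * ip x y - complex.Im a * ip x ('i *: y).
Proof.
rewrite ip_ir /ip linearZl_LR /=.
by case: a => a b; case: (inner x y).
Qed.

Lemma normE x : `|x| = (hnorm x)%:C.
Proof.
by have := normr_ge0 x; rewrite lecE /hnorm /=; case: `|x| => u v /= /andP[/eqP->].
Qed.

Lemma hnorm_ge0 x : 0 <= hnorm x.
Proof. by rewrite -ler0c -normE. Qed.
Local Hint Resolve hnorm_ge0 : core.

Lemma hnormE x : hnorm x ^+ 2 = ip x x.
Proof. by rewrite /ip -inner_norm normE -rmorphXn. Qed.

Lemma ip_ge0 x : 0 <= ip x x.
Proof. by rewrite -hnormE sqr_ge0. Qed.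

Lemma hnormD x y : hnorm (x + y) <= hnorm x + hnorm y.
Proof. by rewrite -lecR rmorphD /= -!normE ler_normD. Qed.

Lemma hnormN x : hnorm (- x) = hnorm x.
Proof. by rewrite /hnorm normrN. Qed.

Lemma hnormB x y : hnorm (x - y) <= hnorm x + hnorm y.
Proof. by rewrite -(hnormN y) hnormD. Qed.

Lemma hnorm0 : hnorm 0 = 0.
Proof. by rewrite /hnorm normr0. Qed.

Lemma hnormZ a x : hnorm (a *: x) = complex.Re `|a| * hnorm x.
Proof. by rewrite /hnorm normrZ normE; case: a => u v /=; rewrite mulr0 subr0. Qed.

Lemma hnormZr r x : hnorm (r%:C *: x) = `|r| * hnorm x.
Proof. by rewrite hnormZ normc_def /= expr0n addr0 sqrtr_sqr. Qed.

Lemma hnorm_i x : hnorm ('i *: x) = hnorm x.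
Proof. by rewrite hnormZ normc_def /= expr0n expr1n add0r sqrtr1 mul1r. Qed.

Lemma hnorm0_eq0 x : hnorm x = 0 -> x = 0.
Proof. by move=> h; apply/eqP; rewrite -normr_eq0 normE h. Qed.

Lemma ip0_eq0 x : ip x x = 0 -> x = 0.
Proof.
by move=> h; apply: hnorm0_eq0; apply/eqP; rewrite -sqrf_eq0 hnormE h.
Qed.

(** Testing against every [z] reduces an identity of vectors to one of reals; many vector identities
    below are proved this way. *)
Lemma ip_ext x y : (forall z, ip x z = ip y z) -> x = y.
Proof.
move=> h; apply/eqP; rewrite -subr_eq0; apply/eqP/ip0_eq0.
by rewrite ipDl ipNl h subrr.
Qed.

(** Cauchy-Schwarz, read off from the reverse triangle inequality by squaring it and expanding
    [ip (x - y) (x - y)]. *)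
Lemma ip_hnorm x y : ip x y <= hnorm x * hnorm y.
Proof.
have h1 : ip (x - y) (x - y) = ip x x + ip y y - 2 * ip x y.
  by rewrite ipDl !ipDr !ipNl !ipNr (ipC y x); ring.
have h2 : hnorm x - hnorm y <= hnorm (x - y).
  by rewrite lerBlDr (le_trans _ (hnormD _ _))// subrK.
have h3 : hnorm y - hnorm x <= hnorm (x - y).
  rewrite lerBlDr -(hnormN (x - y)) opprB (le_trans _ (hnormD _ _))//.
  by rewrite subrK.
rewrite -!hnormE in h1.
have : (hnorm x - hnorm y) ^+ 2 <= hnorm (x - y) ^+ 2.
  by rewrite -ler_sqrt ?sqr_ge0// !sqrtr_sqr (ger0_norm (hnorm_ge0 _)) ler_norml; lra.
by rewrite h1 => h; nra.
Qed.

Lemma normr_ip x y : `|ip x y| <= hnorm x * hnorm y.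
Proof. by rewrite ler_norml ip_hnorm andbT lerNl -ipNl -(hnormN x) ip_hnorm. Qed.

End real_inner_product.

(** * Bounds and completeness with real constants; the Lax-Milgram lemma *)

Section bounded_operators.
Context (R : realType) (H : hilbertType R).
Implicit Types (x y f : H) (T : {linear H -> H}).

Lemma real_complex_gt0 (e : R[i]) : 0 < e -> e = (complex.Re e)%:C.
Proof. by case: e => a b; rewrite ltcE /= => /andP[/eqP -> _]. Qed.

Lemma linear_scale T a x : T (a *: x) = a *: T x.
Proof. exact: linearZ_LR. Qed.

Lemma bounded_opP T :
  bounded_op T -> exists2 M, 0 < M & forall x, hnorm (T x) <= M * hnorm x.
Proof.
move=> /linear_boundedP/pinfty_ex_gt0[M M0 h].
exists (complex.Re M); first by rewrite -ltcR -real_complex_gt0.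
by move=> x; rewrite -lecR rmorphM /= -!normE -real_complex_gt0.
Qed.

Lemma bounded_op_hnorm T M :
  (forall x, hnorm (T x) <= M * hnorm x) -> bounded_op T.
Proof.
move=> h; apply/linear_boundedP; near=> r => x; rewrite (@le_trans _ _ (M%:C * `|x|))//.
  by rewrite !normE -rmorphM /= lecR.
rewrite ler_wpM2r//.
by near: r; apply: nbhs_pinfty_ge; rewrite realE -[0]/(0%:C) !lecR -realE num_real.
Unshelve. all: by end_near. Qed.

Lemma hilbert_complete (u : nat -> H) :
  (forall e, 0 < e -> exists N, forall n, (N <= n)%N -> hnorm (u N - u n) < e) ->
  exists x, forall e, 0 < e -> exists N, forall n, (N <= n)%N -> hnorm (x - u n) < e.
Proof.
move=> hu; have /cauchy_cvgP/cvg_ex[/= x ux] : cauchy (u @ \oo).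
  apply: cauchy_exP => /= e e0.
  have /hu[N hN] : 0 < complex.Re e by rewrite -ltcR -real_complex_gt0.
  exists (u N); exists N => // n /= /hN; rewrite -ltcR -normE -real_complex_gt0//.
  by rewrite -ball_normE.
exists x => e e0.
have /(cvgrPdist_lt _ _).1 : u n @[n --> \oo] --> x by [].
have e0' : 0 < e%:C by rewrite ltcR.
move=> /(_ _ e0')[N _ hN]; exists N => n /hN /=.
by rewrite normE ltcR.
Qed.

Lemma geometric_complete (u : nat -> H) (q d : R) : 0 <= q -> q < 1 ->
  (forall n, hnorm (u n.+1 - u n) <= q ^+ n * d) ->
  exists x, forall e, 0 < e -> exists N, forall n, (N <= n)%N -> hnorm (x - u n) < e.
Proof.
move=> q0 q1 hu.
have d0 : 0 <= d by have := hu 0%N; rewrite mul1r; apply: le_trans; exact: hnorm_ge0.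
(* The closed form of the geometric sum is what the induction on [k] can carry. *)
have hd N k : hnorm (u N - u (N + k)%N) <= (q ^+ N - q ^+ (N + k)) / (1 - q) * d.
  elim: k => [|k IH]; first by rewrite addn0 !subrr hnorm0 !mul0r.
  rewrite (_ : u N - _ = (u N - u (N + k)%N) - (u (N + k.+1)%N - u (N + k)%N)); last first.
    by rewrite opprB addrA subrK.
  apply: le_trans (hnormB _ _) _; rewrite addnS.
  apply: le_trans (lerD IH (hu _)) _.
  rewrite exprS -mulrDl ler_wpM2r// le_eqVlt; apply/orP; left; apply/eqP.
  by field; lra.
apply: hilbert_complete => e e0.
have q1' : `|q| < 1 by rewrite ger0_norm.
have /cvgrPdist_lt := cvg_expr q1'.
(* Dividing by [d + 1] rather than [d] covers the case [d = 0]. *)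
have e1 : 0 < e * (1 - q) / (d + 1) by rewrite divr_gt0 ?mulr_gt0//; lra.
move=> /(_ _ e1)[N _ /(_ N (leqnn N))] /=.
rewrite sub0r normrN ger0_norm ?exprn_ge0// => hN.
exists N => n Nn; rewrite -(subnKC Nn); apply: le_lt_trans (hd _ _) _.
have : 0 <= q ^+ (N + (n - N)) by exact: exprn_ge0.
move: hN; rewrite ltr_pdivlMr; last lra.
have : 0 <= q ^+ N by exact: exprn_ge0.
set a := q ^+ N; set b := q ^+ _ => a0 hN b0.
rewrite mulrAC ltr_pdivrMr; last lra.
nra.
Qed.

(* Lax-Milgram: for small rho > 0 the map x |-> x - rho (T x - f) is a strict
   contraction. *)
Lemma coercive_surjective (T : H -> H) (M c : R) f : 0 < c ->
  (forall x y, T (x - y) = T x - T y) ->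
  (forall x, hnorm (T x) <= M * hnorm x) ->
  (forall x, c * ip x x <= ip (T x) x) -> exists x, T x = f.
Proof.
move=> c0 TB hM hc.
(* Enlarging [M] is harmless, and [c <= M] makes the constant [k = 1 - c^2 / M^2] below
   nonnegative. *)
wlog cM : M hM / c <= M.
  move=> /(_ (Num.max c M)); apply; last by rewrite le_max lexx.
  move=> x; apply: le_trans (hM x) _.
  by rewrite ler_wpM2r ?hnorm_ge0// le_max lexx orbT.
have M0 : 0 < M by exact: lt_le_trans cM.
have M20 : 0 < M ^+ 2 by rewrite exprn_gt0.
(* The minimizer of [1 - 2 rho c + rho^2 M^2], which bounds the squared norm of [1 - rho T]; the
   minimum is [k]. *)
have [rho rho0 rhoE] : exists2 rho, 0 < rho & rho * M ^+ 2 = c.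
  by exists (c / M ^+ 2); [rewrite divr_gt0|rewrite divfK ?gt_eqF].
pose k := 1 - rho * c.
have k0 : 0 <= k.
  have : c * c <= M * M by apply: ler_pM => //; exact: ltW.
  rewrite -expr2 -(ler_pM2l rho0) -[M * M]expr2 rhoE => h.
  by rewrite /k subr_ge0 -(ler_pM2r c0) mul1r -mulrA -expr2.
have k1 : k < 1 by rewrite /k ltrBlDr ltrDl mulr_gt0.
have contr d : hnorm (d - rho%:C *: T d) <= Num.sqrt k * hnorm d.
  rewrite -(@ler_pXn2r _ 2)// ?nnegrE ?mulr_ge0 ?sqrtr_ge0 ?hnorm_ge0//.
  rewrite exprMn sqr_sqrtr// !hnormE ipDl !ipDr !ipNl !ipNr !ipZl !ipZr (ipC d).
  have h1 := hc d.
  have h2 : rho * rho * ip (T d) (T d) <= rho * rho * (M ^+ 2 * ip d d).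
    rewrite (ler_pM2l (mulr_gt0 rho0 rho0)) -!hnormE -exprMn.
    by rewrite lerXn2r ?nnegrE ?mulr_ge0 ?hnorm_ge0// ltW.
  have e1 : rho * rho * (M ^+ 2 * ip d d) = rho * (c * ip d d).
    by rewrite -rhoE; ring.
  have e2 : k * ip d d = ip d d - rho * (c * ip d d) by rewrite /k; ring.
  rewrite e2; rewrite e1 in h2.
  have h3 : rho * (c * ip d d) <= rho * ip (T d) d by rewrite ler_pM2l.
  lra.
pose g x := x - rho%:C *: (T x - f).
pose u n := iter n g 0.
have gB x y : g x - g y = (x - y) - rho%:C *: T (x - y).
  by apply: ip_ext => z; rewrite /g TB !(ipDl, ipNl, ipZl); ring.
have us n : u n.+1 - u n = - (rho%:C *: (T (u n) - f)).
  by apply: ip_ext => z; rewrite /= -/(u n) /g !(ipDl, ipNl, ipZl); ring.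
have hu n : hnorm (u n.+1 - u n) <= Num.sqrt k ^+ n * hnorm (u 1%N - u 0%N).
  elim: n => [|n IH]; first by rewrite mul1r.
  rewrite (_ : u n.+2 - _ = g (u n.+1) - g (u n))// gB.
  by rewrite (le_trans (contr _))// exprS -mulrA ler_wpM2l// sqrtr_ge0.
have k1' : Num.sqrt k < 1 by rewrite -sqrtr1 ltr_sqrt.
have [x hx] := geometric_complete (sqrtr_ge0 _) k1' hu.
exists x; apply/eqP; rewrite -subr_eq0; apply/eqP/hnorm0_eq0/eqP.
rewrite eq_le hnorm_ge0 andbT leNgt; apply/negP => e0.
(* When [u m] and [u m.+1] are within [eta] of [x], the residual [T x - f] has norm at most
   [(M + 2 / rho) * eta]; the chosen [eta] makes this less than [hnorm (T x - f)], a
   contradiction. *)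
have e1 : 0 < hnorm (T x - f) / (2 * M + 2 / rho).
  by rewrite divr_gt0// addr_gt0 ?mulr_gt0 ?invr_gt0.
have [m hm] := hx _ e1.
have h1 : hnorm (x - u m) < hnorm (T x - f) / (2 * M + 2 / rho).
  exact: hm.
have h2 : hnorm (x - u m.+1) < hnorm (T x - f) / (2 * M + 2 / rho).
  by apply: hm; exact: leqnSn.
have hT := hM (x - u m).
have : T x - f = T (x - u m) - (rho^-1)%:C *: (u m.+1 - u m).
  rewrite us scalerN opprK scalerA -rmorphM /= mulVf ?gt_eqF// scale1r.
  by rewrite TB addrA subrK.
move=> /(congr1 (@hnorm _ _)) eT.
have h3 : hnorm (u m.+1 - u m) <= hnorm (x - u m) + hnorm (x - u m.+1).
  apply: le_trans (hnormB _ _); rewrite (_ : u m.+1 - u m = (x - u m) - (x - u m.+1))//.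
  by apply: ip_ext => z; rewrite !(ipDl, ipNl); ring.
have h4 : hnorm (T x - f) <=
    hnorm (T (x - u m)) + rho^-1 * hnorm (u m.+1 - u m).
  rewrite eT (le_trans (hnormB _ _))// hnormZr ger0_norm// invr_ge0 ltW//.
have r0 : 0 < rho^-1 by rewrite invr_gt0.
have h5 : rho^-1 * hnorm (u m.+1 - u m) <=
    rho^-1 * (hnorm (x - u m) + hnorm (x - u m.+1)) by rewrite ler_pM2l.
have p : 0 < 2 * M + 2 / rho by rewrite addr_gt0 ?mulr_gt0 ?invr_gt0.
move: h1 h2; rewrite !ltr_pdivlMr// => h1 h2.
have p1 : 0 <= rho^-1 * hnorm (x - u m.+1) by rewrite mulr_ge0 ?hnorm_ge0 ?ltW.
have p2 : 0 <= rho^-1 * hnorm (x - u m) by rewrite mulr_ge0 ?hnorm_ge0 ?ltW.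
have p3 : 0 <= M * hnorm (x - u m) by rewrite mulr_ge0 ?hnorm_ge0 ?ltW.
have p4 : 0 <= M * hnorm (x - u m.+1) by rewrite mulr_ge0 ?hnorm_ge0 ?ltW.
by lra.
Qed.

End bounded_operators.

(** * Orthogonality and additivity of projection-valued measures *)

Section projection_valued_measures.
Context (R : realType) (H : hilbertType R) (E : pvm H).
Implicit Types (x y : H) (B C : set (measurableTypeR R)).

Lemma self_adjoint_ip (A : H -> H) :
  self_adjoint A -> forall x y, ip (A x) y = ip x (A y).
Proof. by move=> saA x y; rewrite /ip saA. Qed.

Lemma scalar_measureE x B : measurable B ->
  scalar_measure E x B = (ip (E B x) x)%:E.
Proof. by move=> mB; rewrite /scalar_measure asboolT. Qed.

Lemma pvm_ip B x y : measurable B -> ip (E B x) (E B y) = ip (E B x) y.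
Proof.
by move=> mB; rewrite -(self_adjoint_ip (pvm_self_adjoint E mB)) pvm_idem.
Qed.

Lemma scalar_measure_hnorm x B : measurable B ->
  scalar_measure E x B = (hnorm (E B x) ^+ 2)%:E.
Proof. by move=> mB; rewrite scalar_measureE// hnormE pvm_ip. Qed.

Lemma pvm_disjoint B C x : measurable B -> measurable C -> B `&` C = set0 ->
  E B (E C x) = 0.
Proof. by move=> mB mC BC; rewrite -pvm_setI// BC pvm_set0. Qed.

(** Additivity of the scalar measure, together with orthogonality of the two ranges, makes the
    squared norm of the difference of both sides vanish. *)
Lemma pvm_setC B x : measurable B -> x = E B x + E (~` B) x.
Proof.
move=> mB; have mBC : measurable (~` B) by exact: measurableC.
have : scalar_measure E x (B `|` ~` B) =
    (scalar_measure E x B + scalar_measure E x (~` B))%E.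
  by rewrite measureU// setICr.
rewrite setUCr !scalar_measureE// -EFinD pvm_setT => -[h].
apply/eqP; rewrite -subr_eq0; apply/eqP/ip0_eq0.
have h1 : ip (E B x) (E (~` B) x) = 0.
  by rewrite (self_adjoint_ip (pvm_self_adjoint E mB)) pvm_disjoint ?setICr ?ip0r.
rewrite !(ipDl, ipDr, ipNl, ipNr) (ipC x (E B x)) (ipC x (E (~` B) x)).
by rewrite (ipC (E (~` B) x) (E B x)) h1 !pvm_ip// h; ring.
Qed.

(** Pythagoras for the decomposition [pvm_setC]. *)
Lemma hnorm_pvm B x : measurable B -> hnorm (E B x) <= hnorm x.
Proof.
move=> mB; rewrite -(@ler_pXn2r _ 2)// ?nnegrE ?hnorm_ge0// !hnormE.
have mBC : measurable (~` B) by exact: measurableC.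
have h1 : ip (E B x) (E (~` B) x) = 0.
  by rewrite (self_adjoint_ip (pvm_self_adjoint E mB)) pvm_disjoint ?setICr ?ip0r.
rewrite [in leRHS](pvm_setC x mB) !(ipDl, ipDr) (ipC (E (~` B) x) (E B x)) h1.
by rewrite addr0 add0r lerDl ip_ge0.
Qed.

Lemma scalar_measure_setI x B C : measurable B -> measurable C ->
  scalar_measure E (E B x) C = scalar_measure E x (B `&` C).
Proof.
move=> mB mC; have mI : measurable (B `&` C) by exact: measurableI.
by rewrite !scalar_measure_hnorm// setIC pvm_setI.
Qed.

(** * The quadratic form of [A] on spectral subspaces *)

Section spectral.
Variables (A : H -> H) (sAE : spectral_pvm A E).

Lemma spectral_ip x :
  ip (A x) x = \int[scalar_measure E x]_(l in setT) l.
Proof. by have [_] := sAE x; rewrite /ip => ->. Qed.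

Lemma spectral_integrable x B : measurable B ->
  (scalar_measure E x).-integrable B (EFin : R -> \bar R).
Proof.
by move=> mB; have [h _] := sAE x; apply: integrableS h.
Qed.

(** By [scalar_measure_setI] the scalar measure of [E B x] is that of [x] restricted to [B], so the
    integral over the complement vanishes. *)
Lemma spectral_ip_pvm x B : measurable B ->
  ip (A (E B x)) (E B x) = \int[scalar_measure E x]_(l in B) l.
Proof.
move=> mB; have mBC : measurable (~` B) by exact: measurableC.
rewrite spectral_ip -{1}(setUCr B) Rintegral_setU//; last 2 first.
- by rewrite setUCr; exact: spectral_integrable.
- by apply/disj_setPS; rewrite setICr.
rewrite [X in _ + X](_ : _ = 0) ?addr0.
  rewrite /Rintegral; congr fine; apply: eq_measure_integral => C mC CB.
  have := scalar_measure_setI x mB mC; rewrite setIidr// => <-.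
rewrite /Rintegral null_set_integral//; last first.
  have := scalar_measure_setI x mB mBC.
  by rewrite setICr [RHS]measure0.
Qed.

(** The absence of a cross term is what forces [A] to commute with [E B] in [pvm_commute]. *)
Lemma spectral_ip_split x B : measurable B ->
  ip (A x) x = ip (A (E B x)) (E B x) + ip (A (E (~` B) x)) (E (~` B) x).
Proof.
move=> mB; have mBC : measurable (~` B) by exact: measurableC.
rewrite !spectral_ip_pvm// spectral_ip -{1}(setUCr B) Rintegral_setU//.
- by rewrite setUCr; exact: spectral_integrable.
- by apply/disj_setPS; rewrite setICr.
Qed.

Lemma spectral_ge x B (a : R) : measurable B -> (forall l, B l -> a <= l) ->
  a * ip (E B x) (E B x) <= ip (A (E B x)) (E B x).
Proof.
move=> mB aB; rewrite spectral_ip_pvm// pvm_ip//.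
have -> : a * ip (E B x) x = \int[scalar_measure E x]_(l in B) a.
  rewrite Rintegral_cst//; congr (_ * _).
  exact: (congr1 fine (esym (scalar_measureE x mB))).
apply: le_Rintegral => //.
- by apply: finite_measure_integrable_cst.
- exact: spectral_integrable.
Qed.

Lemma spectral_le x B (a : R) : measurable B -> (forall l, B l -> l <= a) ->
  ip (A (E B x)) (E B x) <= a * ip (E B x) (E B x).
Proof.
move=> mB aB; rewrite spectral_ip_pvm// pvm_ip//.
have -> : a * ip (E B x) x = \int[scalar_measure E x]_(l in B) a.
  rewrite Rintegral_cst//; congr (_ * _).
  exact: (congr1 fine (esym (scalar_measureE x mB))).
apply: le_Rintegral => //.
- exact: spectral_integrable.
- by apply: finite_measure_integrable_cst.
Qed.

End spectral.

(** * Commutation of [A] with its spectral projections *)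

Section commutation.
Variables (A : {linear H -> H}) (saA : self_adjoint A).
Hypothesis sAE : spectral_pvm A E.

(** With [u = E C y] and [v = E (~] C) (A u)[, splitting the form at]u + v[kills the cross term]ip
    (A u) v[, which equals]ip v v[. So]A[preserves the ranges of both]E B[and]E (~[B)]. *)
Lemma pvm_commute B x : measurable B -> A (E B x) = E B (A x).
Proof.
suff key C y : measurable C -> E (~` C) (A (E C y)) = 0.
  move=> mB; have mBC : measurable (~` B) by exact: measurableC.
  have h1 := key _ x mB; have h2 := key _ x mBC; rewrite setCK in h2.
  rewrite [in RHS](pvm_setC x mB) !linearD /= h2 addr0.
  by rewrite [LHS](pvm_setC _ mB) h1 addr0.
move=> mC; have mCC : measurable (~` C) by exact: measurableC.
set u := E C y; set v := E (~` C) (A u).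
have uE : E C (u + v) = u.
  by rewrite linearD /= /u pvm_idem// /v pvm_disjoint ?setICr// addr0.
have vE : E (~` C) (u + v) = v.
  by rewrite linearD /= /v pvm_idem// /u pvm_disjoint ?setICl// add0r.
have := spectral_ip_split sAE (u + v) mC.
rewrite uE vE linearD /= !(ipDl, ipDr).
rewrite (self_adjoint_ip saA v u) (ipC v (A u)) => h.
have {}h : ip (A u) v = 0 by lra.
by apply: ip0_eq0; move: h; rewrite ipC /v -pvm_ip// => ->.
Qed.

(* By polarization: the quadratic form of A - c on ran E(D) is bounded by e. *)
Lemma spectral_near (D : set (measurableTypeR R)) (c e : R) x :
  measurable D -> 0 <= e -> (forall l, D l -> c - e <= l <= c + e) ->
  hnorm (A (E D x) - c%:C *: E D x) <= e * hnorm (E D x).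
Proof.
move=> mD e0 De; pose T y := A y - c%:C *: y.
have TE y : T (E D y) = E D (T y).
  by rewrite /T (linearB (E D)) (linear_scale (E D)) pvm_commute.
have Tsa y z : ip (T y) z = ip y (T z).
  by rewrite /T !(ipDl, ipDr, ipNl, ipNr, ipZl, ipZr) (self_adjoint_ip saA).
have TD y z : T (y + z) = T y + T z.
  by apply: ip_ext => w; rewrite /T (linearD A) !(ipDl, ipNl, ipZl); ring.
have TN y : T (- y) = - T y.
  by apply: ip_ext => w; rewrite /T (linearN A) !(ipDl, ipNl, ipZl); ring.
have num y : `|ip (T (E D y)) (E D y)| <= e * ip (E D y) (E D y).
  have h1 := @spectral_ge A sAE y D (c - e) mD (fun l Dl => proj1 (andP (De l Dl))).
  have h2 := @spectral_le A sAE y D (c + e) mD (fun l Dl => proj2 (andP (De l Dl))).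
  by rewrite ler_norml /T ipDl ipNl ipZl; apply/andP; split; lra.
have TZ r w : T (r%:C *: w) = r%:C *: T w.
  by apply: ip_ext => v; rewrite /T (linear_scale A) !(ipDl, ipNl, ipZl); ring.
rewrite -/(T (E D x)); move: T TE Tsa TD TN num TZ => T TE Tsa TD TN num TZ.
set y := E D x; set z := T y.
have zE : z = E D (T x) by rewrite /z /y TE.
(* The bounds at [y + r z] and [y - r z], both in the range of [E D], are subtracted; the
   parallelogram law adds up the right-hand sides. *)
have pol r : 2 * r * ip z z <= e * (ip y y + r ^+ 2 * ip z z).
  have h1 := num (x + r%:C *: T x); have h2 := num (x - r%:C *: T x).
  move: h1 h2; rewrite (linearD (E D)) (linearB (E D)) (linear_scale (E D)) /= -zE -/y.
  rewrite !ler_norml => /andP[_ h1] /andP[h2 _].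
  move: h1 h2; rewrite !TD !TN !TZ -/z.
  rewrite !(ipDl, ipDr, ipNl, ipNr, ipZl, ipZr) (Tsa z y) -/z (ipC z y) => h1 h2.
  lra.
rewrite -(@ler_pXn2r _ 2)// ?nnegrE ?mulr_ge0 ?hnorm_ge0// exprMn !hnormE -/z.
have := ip_ge0 z; have := ip_ge0 y.
move: e0; rewrite le_eqVlt => /predU1P[e0|e0].
  by have := pol 1; rewrite -e0 => *; lra.
(* The choice [r = e^-1] gives [2 |z|^2 <= e^2 |y|^2 + |z|^2]; the case [e = 0] was treated
   apart. *)
have := pol e^-1 => h y0 z0.
have h' : e * (2 * e^-1 * ip z z) <= e * (e * (ip y y + e^-1 ^+ 2 * ip z z)).
  by rewrite ler_pM2l.
have e1 : e * (2 * e^-1 * ip z z) = 2 * ip z z by field; rewrite gt_eqF.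
have e2 : e * (e * (ip y y + e^-1 ^+ 2 * ip z z)) = e ^+ 2 * ip y y + ip z z.
  by field; rewrite gt_eqF.
lra.
Qed.

End commutation.
End projection_valued_measures.

(** * The coefficients of the resolvent expansion and their energy balance *)

Section averaging_sequence.
Context (R : realType) (H : hilbertType R).
Variables (A L : {linear H -> H}).
Hypotheses (saA : self_adjoint A) (saL : self_adjoint L).
Hypothesis L0 : forall x, 0 <= ip (L x) x.
Variables (MA ML : R).
Hypotheses (bA : forall x, hnorm (A x) <= MA * hnorm x)
           (bL : forall x, hnorm (L x) <= ML * hnorm x).
Variables (c e : R).
Hypothesis e0 : 0 < e.
Implicit Types (x y u : H) (t : R).

(* A - i L - (c + i e) *)
Definition dissipative u := A u - c%:C *: u - 'i *: (e%:C *: u + L u).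

Let ip_A x : ip (A x) ('i *: x) = 0.
Proof.
have : ip (A x) ('i *: x) = - ip (A x) ('i *: x).
  rewrite {1}(self_adjoint_ip saA) linear_scale.
  by rewrite (ipC (A x)) ip_Ni opprK.
by move=> h; lra.
Qed.

(** After multiplication by ['i] the self-adjoint part [A - c] contributes nothing to the form,
    leaving the coercive [e + L]. *)
Lemma dissipative_ip u :
  ip ('i *: dissipative u) u = e * ip u u + ip (L u) u.
Proof.
rewrite ip_Ni /dissipative !(ipDl, ipNl, ipZl) ip_ii !(ipDl, ipZl) ip_A.
have := ip_i_diag u; rewrite ip_Ni => h.
have {}h : ip u ('i *: u) = 0 by lra.
by rewrite h; ring.
Qed.

Lemma dissipative_ge u : e * hnorm u <= hnorm (dissipative u).
Proof.
have [->|u0] := eqVneq (hnorm u) 0; first by rewrite mulr0 hnorm_ge0.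
have {}u0 : 0 < hnorm u by rewrite lt_neqAle eq_sym u0 hnorm_ge0.
rewrite -(ler_pM2r u0) -mulrA -expr2 hnormE -(hnorm_i (dissipative u)).
apply: le_trans (ip_hnorm _ _); rewrite dissipative_ip.
by rewrite lerDl.
Qed.

(** Lax-Milgram applies to ['i] times the operator, coercive with constant [e] by
    [dissipative_ip]. *)
Lemma dissipative_surjective y : exists u, dissipative u = y.
Proof.
pose T u := 'i *: dissipative u.
have TB x z : T (x - z) = T x - T z.
  apply: ip_ext => w; rewrite /T /dissipative !(linearB A) !(linearB L).
  by rewrite !(ipDl, ipNl, ipZl, ip_Ni); ring.
have TM x : hnorm (T x) <= (MA + `|c| + (e + ML)) * hnorm x.
  rewrite hnorm_i /dissipative (le_trans (hnormB _ _))// hnorm_i !mulrDl.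
  apply: lerD.
    by rewrite (le_trans (hnormB _ _))// lerD// hnormZr.
  by rewrite (le_trans (hnormD _ _))// lerD// hnormZr gtr0_norm.
have Tc x : e * ip x x <= ip (T x) x by rewrite dissipative_ip lerDl.
have [u hu] := coercive_surjective ('i *: y) e0 TB TM Tc.
exists u; move/(congr1 (fun x => (- 'i) *: x)) : hu.
by rewrite /T !scalerA mulNr -expr2 sqr_i opprK !scale1r.
Qed.

(* Junk value 0 if the equation were not solvable; see [resolvent_stepE]. *)
Definition resolvent_step y := xget 0 [set u | dissipative u = L y].

Lemma resolvent_stepE y : dissipative (resolvent_step y) = L y.
Proof.
by rewrite /resolvent_step; case: xgetP => //= /(_ _ (projT2 (cid (dissipative_surjective (L y))))).
Qed.

(* With P = dissipative and u_n = avg_u y n, the series \sum (- w)^n u_n is the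
   formal expansion of (P + w (P + 2 i L))^-1 (L y). *)
Fixpoint avg_y y n := if n is n'.+1 then
  avg_y y n' + 2%:C *: ('i *: resolvent_step (avg_y y n')) else y.

Definition avg_u y n := resolvent_step (avg_y y n).

Lemma avg_yS y n : avg_y y n.+1 = avg_y y n + 2%:C *: ('i *: avg_u y n).
Proof. by []. Qed.

(** The cross terms [4 * ip (L v) ('i *: u)] equal [- 4 * e * ip u u - 4 * ip (L u) u] by
    [dissipative_ip], and the last summand cancels the quadratic term of the expansion. *)
Lemma avg_energy y n : ip (L (avg_y y n.+1)) (avg_y y n.+1) =
  ip (L (avg_y y n)) (avg_y y n) - 4 * e * ip (avg_u y n) (avg_u y n).
Proof.
rewrite avg_yS; set v := avg_y y n; set u := avg_u y n.
have := dissipative_ip u; rewrite resolvent_stepE -/v => h.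
rewrite (linearD L) !(linear_scale L) !(ipDl, ipDr) !(ipZl, ipZr) ip_ii.
have h1 : ip ('i *: L u) v = ip (L v) ('i *: u).
  by rewrite -linear_scale (self_adjoint_ip saL) ipC.
by move: h; rewrite h1 ip_Ni => h; lra.
Qed.

(** The energies telescope, and the last one is nonnegative. *)
Lemma avg_u_sum y n :
  \sum_(0 <= k < n) ip (avg_u y k) (avg_u y k) <= ip (L y) y / (4 * e).
Proof.
have e40 : 0 < 4 * e by rewrite mulr_gt0.
have : \sum_(0 <= k < n) ip (avg_u y k) (avg_u y k) =
    (ip (L y) y - ip (L (avg_y y n)) (avg_y y n)) / (4 * e).
  elim: n => [|n IH]; first by rewrite big_geq// subrr mul0r.
  by rewrite big_nat_recr//= IH -[avg_y y n + _]avg_yS avg_energy; field; rewrite gt_eqF.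
by move=> ->; rewrite ler_pM2r ?invr_gt0// gerBl.
Qed.

Lemma hnorm_avg_y y n :
  hnorm (avg_y y n) <= hnorm y + 2 * \sum_(0 <= k < n) hnorm (avg_u y k).
Proof.
elim: n => [|n IH]; first by rewrite big_geq//= mulr0 addr0.
rewrite avg_yS (le_trans (hnormD _ _))// hnormZr hnorm_i big_nat_recr//= mulrDr.
by rewrite addrA lerD// ger0_norm.
Qed.

(** The inequality [a <= (1/m + m a^2) / 2] balances the number [m^2 + 1] of terms against the
    bounded sum of squares. *)
Lemma avg_u_sum1 y (m : nat) : (0 < m)%N ->
  \sum_(0 <= k < (m ^ 2).+1) hnorm (avg_u y k) <=
    m%:R * (1 + ip (L y) y / (4 * e)).
Proof.
move=> m0; have m0' : 0 < m%:R :> R by rewrite ltr0n.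
have amgm (a : R) : a <= (m%:R^-1 + m%:R * a ^+ 2) / 2.
  have h : m%:R^-1 * (m%:R * a - 1) ^+ 2 = m%:R * a ^+ 2 - 2 * a + m%:R^-1.
    by field; rewrite gt_eqF.
  have : 0 <= m%:R^-1 * (m%:R * a - 1) ^+ 2 by rewrite mulr_ge0 ?sqr_ge0// invr_ge0 ltW.
  by rewrite h => {}h; lra.
apply: (@le_trans _ _ (\sum_(0 <= k < (m ^ 2).+1)
    (m%:R^-1 + m%:R * ip (avg_u y k) (avg_u y k)) / 2)).
  by apply: ler_sum => k _; rewrite -hnormE.
rewrite -mulr_suml big_split /= -mulr_sumr sumr_const_nat subn0.
rewrite -(mulr_natr m%:R^-1) ler_pdivrMr//.
have h := avg_u_sum y (m ^ 2).+1.
have h2 : m%:R^-1 * (m ^ 2).+1%:R <= 2 * m%:R :> R.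
  rewrite mulrC ler_pdivrMr// -mulrA -[(_ * m%:R)]expr2 -natrX -natrM ler_nat.
  by rewrite mul2n -addnn -addn1 leq_add2l expn_gt0 m0.
have h3 : 0 <= m%:R * (ip (L y) y / (4 * e)).
  by rewrite mulr_ge0 ?divr_ge0 ?mulr_ge0// ltW.
move: h; rewrite -(ler_pM2l m0') => h.
by lra.
Qed.

End averaging_sequence.

(** * The coupling as a parameter of the unit circle *)

Section cayley_transform.
Context (R : realType).
Implicit Types (t a : R).

(** The point [exp (- i a)]. *)
Definition phase a : R[i] := Complex (cos a) (- sin a).

Lemma phaseM a b : phase a * phase b = phase (a + b).
Proof. by rewrite /phase cosD sinD; simpc; congr Complex; ring. Qed.

Lemma phaseX a n : phase a ^+ n = phase (n%:R * a).
Proof.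
elim: n => [|n IH]; first by rewrite expr0 mul0r /phase cos0 sin0 oppr0.
by rewrite exprS IH phaseM -natr1 mulrDl mul1r addrC.
Qed.

Lemma normr_phase a : `|phase a| = 1.
Proof.
by rewrite normc_def /= sqrrN cos2Dsin2 sqrtr1.
Qed.

Definition cayley_arg t : R := atan t *+ 2.

(* phase (cayley_arg t) = (1 - i t) / (1 + i t) *)
Definition cayley t : R[i] := phase (cayley_arg t).

Lemma cos_cayley_arg t : cos (cayley_arg t) = 2 / (1 + t ^+ 2) - 1.
Proof.
by rewrite cos_mulr2n cos_atan exprVn sqr_sqrtr ?addr_ge0 ?sqr_ge0// -mulr_natl.
Qed.

Lemma sin_cayley_arg t : sin (cayley_arg t) = 2 * t / (1 + t ^+ 2).
Proof.
have c0 : cos (atan t) != 0 by rewrite cos_atan invr_eq0 gt_eqF// sqrtr_gt0 ltr_pwDl ?sqr_ge0.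
have -> : sin (cayley_arg t) = 2 * t * cos (atan t) ^+ 2.
  rewrite sin_mulr2n -{3}(atanK t) /tan -mulr_natl expr2; field.
  exact: c0.
by rewrite cos_atan exprVn sqr_sqrtr ?addr_ge0 ?sqr_ge0.
Qed.

Let den_gt0 t : 0 < 1 + t ^+ 2.
Proof. by rewrite ltr_pwDl ?sqr_ge0. Qed.

(** The coefficient of [L] in the factorization [(1 + w) (P + (t + i) L) = P + w (P + 2 i L)]. *)
Lemma cayley_eq t : (1 + cayley t) * (t%:C + 'i) = 'i * (cayley t *+ 2).
Proof.
have h := den_gt0 t.
rewrite /cayley /phase cos_cayley_arg sin_cayley_arg -mulr_natl.
by apply/eqP; rewrite eq_complex /=; apply/andP; split; apply/eqP; field; rewrite gt_eqF.
Qed.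

(** This weight is twice the derivative of [cayley_arg], so it converts an integral in [t] into one
    over the circle. *)
Lemma sqr_norm_1cayley t : complex.Re `|1 + cayley t| ^+ 2 = 4 / (1 + t ^+ 2).
Proof.
have h := den_gt0 t.
rewrite normc_def /= sqr_sqrtr ?addr_ge0 ?sqr_ge0//.
rewrite cos_cayley_arg sin_cayley_arg; field; rewrite gt_eqF//.
Qed.

Lemma cayley_neqN1 t : 1 + cayley t != 0.
Proof.
rewrite -normr_eq0; apply/negP => /eqP h; have := sqr_norm_1cayley t.
rewrite h /= expr0n /= => /esym/eqP; rewrite mulf_eq0 invr_eq0.
by rewrite (gt_eqF (den_gt0 t)) orbF pnatr_eq0.
Qed.

End cayley_transform.

(** * Cesaro means as approximate solutions of the resolvent equation *)

Section averaging_error.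
Context (R : realType) (H : hilbertType R).
Variables (A L : {linear H -> H}).
Hypotheses (saA : self_adjoint A) (saL : self_adjoint L).
Hypothesis L0 : forall x, 0 <= ip (L x) x.
Variables (MA ML : R).
Hypotheses (ML0 : 0 <= ML) (bA : forall x, hnorm (A x) <= MA * hnorm x)
           (bL : forall x, hnorm (L x) <= ML * hnorm x).
Variables (c e : R).
Hypothesis e0 : 0 < e.
Variables (y : H) (t : R).

Local Notation w := (cayley t).
Local Notation yy := (avg_y A L c e y).
Local Notation uu := (avg_u A L c e y).

(** The operator [A + t L - (c + i e)]. *)
Definition perturbed x := A x + t%:C *: L x - c%:C *: x - 'i *: (e%:C *: x).

Definition avg_term n : H := ((1 + w) * (- w) ^+ n) *: uu n.

(** The sum of the first [N] nonempty partial sums of the series of [avg_term]; [avg_vec] divides by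
    their number. *)
Definition avg_sum N : H := \sum_(0 <= n < N) (N - n)%:R%:C *: avg_term n.

Let perturbedD x z : perturbed (x + z) = perturbed x + perturbed z.
Proof.
apply: ip_ext => v; rewrite /perturbed !(linearD A) !(linearD L).
by rewrite !(ipDl, ipNl, ipZl, ip_Ni); ring.
Qed.

Let perturbedZ (a : R[i]) x : perturbed (a *: x) = a *: perturbed x.
Proof.
rewrite /perturbed !(linear_scale A) !(linear_scale L) !(scalerA _ a).
rewrite !(mulrC _ a) -!scalerA !scalerBr !scalerDr; congr (_ - _).
by rewrite !scalerA; congr (_ *: _); ring.
Qed.

Let perturbedE x : perturbed x = dissipative A L c e x + (t%:C + 'i) *: L x.
Proof.
by apply: ip_ext => v; rewrite /perturbed /dissipative scalerDl scalerDr
  !(ipDl, ipNl, ipZl, ip_Ni); ring.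
Qed.

Let orbit n : H := (- w) ^+ n *: L (yy n).

Let uuE n : dissipative A L c e (uu n) = L (yy n).
Proof. exact: (resolvent_stepE saA L0 bA bL c e0). Qed.

(** Since [P u_n = L y_n] and [(P + 2 i L) u_n = L y_{n+1}], the factorization behind [cayley_eq]
    yields a telescoping difference. *)
Let perturbed_term n : perturbed (avg_term n) = orbit n - orbit n.+1.
Proof.
rewrite /avg_term mulrC -scalerA perturbedZ /orbit exprSr -scalerA -scalerBr.
congr (_ *: _); rewrite perturbedZ perturbedE uuE scalerDr scalerA cayley_eq.
rewrite avg_yS (linearD L) !(linear_scale L) scaleNr opprK scalerDr scalerDl scale1r.
rewrite -addrA; congr (_ + (_ + _)); rewrite !scalerA; congr (_ *: _).
by rewrite rmorph_nat; ring.
Qed.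

(* Summation by parts of the telescoping identity [perturbed_term]. *)
Lemma perturbed_avg_sum N :
  perturbed (avg_sum N) = N%:R%:C *: L y - \sum_(0 <= k < N) orbit k.+1.
Proof.
have p0 : perturbed 0 = 0 by rewrite -[X in perturbed X](scale0r 0) perturbedZ scale0r.
have part k : perturbed (\sum_(0 <= n < k) avg_term n) = L y - orbit k.
  elim: k => [|k IH]; first by rewrite big_geq// p0 /orbit expr0 scale1r subrr.
  by rewrite big_nat_recr//= perturbedD IH perturbed_term addrA subrK.
elim: N => [|N IH]; first by rewrite /avg_sum !big_geq// p0 scale0r subrr.
have -> : avg_sum N.+1 = avg_sum N + \sum_(0 <= n < N.+1) avg_term n.
  rewrite /avg_sum !big_nat_recr//= subSnn scale1r addrA; congr (_ + _).
  rewrite -big_split /= !big_nat; apply: eq_bigr => k /andP[_ kN].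
  by rewrite subSn ?(ltnW kN)// -natr1 rmorphD /= scalerDl scale1r.
rewrite perturbedD IH part big_nat_recr//= -natr1 rmorphD /= scalerDl scale1r.
by rewrite opprD addrACA.
Qed.

Let hnorm_phaseX n (x : H) : hnorm ((- w) ^+ n *: x) = hnorm x.
Proof. by rewrite hnormZ normrX normrN normr_phase expr1n mul1r. Qed.

(** Multiplied by [1 + w], the sum of the orbit telescopes up to corrections in [u_n]; bounding its
    terms one by one would lose a factor [N]. *)
Let orbit_step n : (1 + w) *: orbit n =
  orbit n - orbit n.+1 + (- w) ^+ n.+1 *: L (2%:C *: ('i *: uu n)).
Proof.
rewrite [orbit n.+1]/orbit avg_yS (linearD L) scalerDr opprD addrA subrK.
by rewrite scalerDl scale1r /orbit exprS -scalerA scaleNr opprK.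
Qed.

(** The two boundary terms contribute [2 * ML * hnorm y] and four of the six sums; the corrections
    contribute the other two. *)
Let orbit_sum N : hnorm ((1 + w) *: \sum_(0 <= k < N) orbit k.+1) <=
  2 * ML * hnorm y + 6 * ML * \sum_(0 <= k < N.+1) hnorm (uu k).
Proof.
have orb n : (n <= N.+1)%N ->
    hnorm (orbit n) <= ML * (hnorm y + 2 * \sum_(0 <= k < N.+1) hnorm (uu k)).
  move=> nN; rewrite hnorm_phaseX (le_trans (bL _))// ler_wpM2l//.
  rewrite (le_trans (hnorm_avg_y _ _ _ _ _ _))// lerD2l ler_pM2l//.
  rewrite [leRHS](big_cat_nat _ (n := n))//= lerDl sumr_ge0// => k _; exact: hnorm_ge0.
have : hnorm ((1 + w) *: (\sum_(0 <= k < N) orbit k.+1) - (orbit 1 - orbit N.+1))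
    <= 2 * ML * \sum_(0 <= k < N) hnorm (uu k.+1).
  elim: N {orb} => [|N IH]; first by rewrite !big_geq// scaler0 subrr subrr hnorm0 mulr0.
  rewrite !big_nat_recr//= scalerDr orbit_step.
  set z := _ *: L _.
  rewrite (_ : _ - _ = (1 + w) *: (\sum_(0 <= k < N) orbit k.+1)
     - (orbit 1 - orbit N.+1) + z); last first.
    by apply: ip_ext => v; rewrite !(ipDl, ipNl); ring.
  rewrite (le_trans (hnormD _ _))// mulrDr lerD// /z hnorm_phaseX.
  by rewrite (le_trans (bL _))// hnormZr hnorm_i ger0_norm// mulrCA mulrA.
have h1 := orb 1%N isT; have h2 := orb N.+1 (leqnn _).
set s := (1 + w) *: _ => h.
have h3 : hnorm s <= hnorm (s - (orbit 1 - orbit N.+1)) + (hnorm (orbit 1) + hnorm (orbit N.+1)).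
  rewrite -{1}(subrK (orbit 1 - orbit N.+1) s) (le_trans (hnormD _ _))// lerD2l.
  exact: hnormB.
have h4 : \sum_(0 <= k < N) hnorm (uu k.+1) <= \sum_(0 <= k < N.+1) hnorm (uu k).
  by rewrite [leRHS]big_nat_recl//= lerDr hnorm_ge0.
have h5 : ML * \sum_(0 <= k < N) hnorm (uu k.+1) <= ML * \sum_(0 <= k < N.+1) hnorm (uu k).
  exact: ler_wpM2l.
lra.
Qed.

Definition avg_vec (m : nat) : H := ((m ^ 2)%:R^-1)%:C *: avg_sum (m ^ 2).

(* The Cesaro means over n < m^2: by [avg_u_sum1] the sum of the |u_n| over that
   range is O(m), which the factor m^-2 turns into the rate 1/m. *)
Lemma avg_error : exists C, forall m, (0 < m)%N ->
  hnorm (L y - perturbed (avg_vec m)) <= C / m%:R.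
Proof.
pose D := ip (L y) y / (4 * e).
have D0 : 0 <= D by rewrite divr_ge0 ?mulr_ge0 ?L0// ltW.
(* This factor grows with [t]; the error is only needed at each fixed [t]. *)
pose K := complex.Re `|(1 + w)^-1|.
exists (K * (2 * ML * hnorm y + 6 * ML * (1 + D))) => m m0.
have m0' : 0 < m%:R :> R by rewrite ltr0n.
have m1 : 1 <= m%:R :> R by rewrite ler1n.
have mm : (m ^ 2)%:R = m%:R ^+ 2 :> R by rewrite natrX.
set N := (m ^ 2)%N in mm *.
have N0 : 0 < N%:R :> R by rewrite mm exprn_gt0.
rewrite /avg_vec -/N perturbedZ perturbed_avg_sum scalerBr scalerA -rmorphM /=.
rewrite mulVf ?gt_eqF// scale1r opprB addrCA subrr addr0.
have -> : \sum_(0 <= k < N) orbit k.+1 = (1 + w)^-1 *: ((1 + w) *: \sum_(0 <= k < N) orbit k.+1).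
  by rewrite scalerA mulVf ?cayley_neqN1// scale1r.
rewrite hnormZr gtr0_norm ?invr_gt0// hnormZ -/K.
have K0 : 0 <= K by have := hnorm_ge0; rewrite /K normc_def /= sqrtr_ge0.
have h1 := orbit_sum N.
have h2 := avg_u_sum1 saA saL L0 bA bL c e0 y m0; rewrite -/D -/N in h2.
have h3 : 6 * ML * \sum_(0 <= k < N.+1) hnorm (uu k) <= 6 * ML * (m%:R * (1 + D)).
  by rewrite ler_wpM2l// mulr_ge0.
have h4 : 2 * ML * hnorm y <= m%:R * (2 * ML * hnorm y).
  by rewrite ler_peMl// !mulr_ge0 ?hnorm_ge0.
rewrite ler_pdivlMr// mulrC mulrA mm (_ : m%:R / m%:R ^+ 2 = m%:R^-1); last first.
  by field; rewrite gt_eqF.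
rewrite mulrCA ler_wpM2l// ler_pdivrMl//; lra.
Qed.

End averaging_error.

(** * Parseval on the circle, carried over to the line *)

Section bessel_inequality.
Context (R : realType).

Let trig (j a b : R) (th : R) := a * cos (j * th) + b * sin (j * th).

(** An antiderivative of [trig]; frequency zero has a linear one. *)
Let trig_primitive (j a b : R) (th : R) :=
  if j == 0 then a * th else (a * sin (j * th) - b * cos (j * th)) / j.

Let is_derive_cosM (j th : R) :
  is_derive th 1 (fun x => cos (j * x)) (- (j * sin (j * th))).
Proof.
have h : is_derive th 1 (fun x => j * x) j.
  by apply: is_derive_eq; rewrite /GRing.scale /= mulr1.
have := @is_derive1_comp _ cos (fun x => j * x) th _ _ (is_derive_cos _) h.
by rewrite mulNr mulrC.
Qed.

Let is_derive_sinM (j th : R) :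
  is_derive th 1 (fun x => sin (j * x)) (j * cos (j * th)).
Proof.
have h : is_derive th 1 (fun x => j * x) j.
  by apply: is_derive_eq; rewrite /GRing.scale /= mulr1.
have := @is_derive1_comp _ sin (fun x => j * x) th _ _ (is_derive_sin _) h.
by rewrite mulrC.
Qed.

Let is_derive_trig (j a b th : R) :
  is_derive th 1 (trig j a b) (a * - (j * sin (j * th)) + b * (j * cos (j * th))).
Proof.
apply: is_deriveD; exact: is_deriveZ.
Qed.

Let is_derive_trig_primitive (j a b th : R) :
  is_derive th 1 (trig_primitive j a b) (trig j a b th).
Proof.
rewrite /trig_primitive /trig; case: eqVneq => [->|j0].
  rewrite !mul0r cos0 sin0 mulr0 addr0.
  exact: is_deriveZ.
have h : is_derive th 1 (j^-1 \*: (a \*: (fun x => sin (j * x)) - b \*: (fun x => cos (j * x))))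
   (j^-1 *: (a *: (j * cos (j * th)) - b *: (- (j * sin (j * th))))).
  by apply: is_deriveZ; apply: is_deriveB; exact: is_deriveZ.
rewrite (_ : (fun _ => _) = (j^-1 \*: (a \*: (fun x => sin (j * x)) - b \*: (fun x => cos (j * x))))).
  by apply: is_derive_eq h _; rewrite /GRing.scale /=; field.
by apply/funext => x; rewrite /= mulrC.
Qed.

Context (H : hilbertType R).

Lemma ip_suml n (F : 'I_n -> H) y : ip (\sum_(i < n) F i) y = \sum_(i < n) ip (F i) y.
Proof.
by apply: (big_morph (fun x => ip x y)) => [x z|]; rewrite ?ipDl ?ip0l.
Qed.

Lemma ip_sumr n (F : 'I_n -> H) y : ip y (\sum_(i < n) F i) = \sum_(i < n) ip y (F i).
Proof. by rewrite ipC ip_suml; apply: eq_bigr => i _; rewrite ipC. Qed.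

Lemma ip_phase a b (x z : H) : ip (phase a *: x) (phase b *: z) =
  cos (a - b) * ip x z + sin (a - b) * ip x ('i *: z).
Proof.
have ipr u v : ip u (phase b *: v) = cos b * ip u v - sin b * ip u ('i *: v).
  by rewrite ipC ipZc /= mulNr opprK (ipC v) (ipC v) ip_Ni mulrN.
rewrite ipZc /= scalerA (mulrC 'i) -scalerA !ipr scalerA -expr2 sqr_i scaleN1r ipNr.
by rewrite cosB sinB; ring.
Qed.

Variables (c : nat -> H) (N : nat).

Let alpha (m n : 'I_N) := ip (c m) (c n).
Let beta (m n : 'I_N) := ip (c m) ('i *: c n).
Let freq (m n : 'I_N) : R := m%:R - n%:R.

Let energy (th : R) := \sum_m \sum_n trig (freq m n) (alpha m n) (beta m n) th.
Let energy_primitive (th : R) :=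
  \sum_m \sum_n trig_primitive (freq m n) (alpha m n) (beta m n) th.

Let hnorm_energy th :
  hnorm (\sum_(n < N) phase th ^+ n *: c n) ^+ 2 = energy th.
Proof.
rewrite hnormE ip_suml; apply: eq_bigr => m _; rewrite ip_sumr.
apply: eq_bigr => n _; rewrite !phaseX ip_phase -mulrBl.
by rewrite /trig mulrC [X in _ + X]mulrC.
Qed.

Let is_derive_double (f : 'I_N -> 'I_N -> R -> R) (df : 'I_N -> 'I_N -> R) (th : R) :
  (forall m n : 'I_N, is_derive th 1 (f m n) (df m n)) ->
  is_derive th 1 (fun x : R => \sum_m \sum_n f m n x) (\sum_m \sum_n df m n).
Proof.
move=> h.
rewrite (_ : (fun _ => _) = \sum_m \sum_n f m n); last first.
  by apply/funext => x; rewrite fct_sumE; apply: eq_bigr => m _; rewrite fct_sumE.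
by apply: is_derive_sum => m; exact: is_derive_sum.
Qed.

Let is_derive_energy_primitive (th : R) : is_derive th 1 energy_primitive (energy th).
Proof.
exact: (is_derive_double (fun m n =>
  is_derive_trig_primitive (freq m n) (alpha m n) (beta m n) th)).
Qed.

Let derivable_energy (th : R) : derivable energy th 1.
Proof.
by have [] := is_derive_double (fun m n =>
  is_derive_trig (freq m n) (alpha m n) (beta m n) th).
Qed.

(** The derivative is a squared norm, so the primitive is nondecreasing and [[-pi, pi]] is the worst
    case. There the off-diagonal frequencies, nonzero integers, contribute nothing. *)
Let energy_primitive_le (a b : R) : - pi <= a -> a <= b -> b <= pi ->
  energy_primitive b - energy_primitive a <= 2 * pi * \sum_(n < N) hnorm (c n) ^+ 2.
Proof.
have mono x y : x <= y -> energy_primitive x <= energy_primitive y.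
  move=> xy; apply: (@ger0_derive1_ndecr _ energy_primitive x y).
  - by move=> z _; have [] := is_derive_energy_primitive z.
  - move=> z _; rewrite derive1E (@derive_val _ _ _ _ _ _ _ (is_derive_energy_primitive z)).
    by rewrite -hnorm_energy sqr_ge0.
  - apply: derivable_within_continuous => z _.
    by have [] := is_derive_energy_primitive z.
  - by [].
  - by [].
  - by [].
move=> pia ab bpi.
have h1 := mono _ _ pia; have h2 := mono _ _ bpi.
suff : energy_primitive pi - energy_primitive (- pi) = 2 * pi * \sum_(n < N) hnorm (c n) ^+ 2.
  lra.
rewrite /energy_primitive -sumrB mulr_sumr; apply: eq_bigr => m _.
rewrite -sumrB (bigD1 m)//= big1 ?addr0 => [|n nm].
  by rewrite /trig_primitive /freq subrr eqxx /alpha -hnormE; ring.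
have /negbTE mn : (m : nat) != n by rewrite eq_sym; exact: nm.
rewrite /trig_primitive /freq subr_eq0 eqr_nat mn.
have sin_nat k : sin (k%:R * pi) = 0 :> R.
  elim: k => [|k IH]; first by rewrite mul0r sin0.
  by rewrite -natr1 mulrDl mul1r sinD IH sinpi mul0r mulr0 addr0.
have hs : sin ((m%:R - n%:R) * pi) = 0 :> R.
  by rewrite mulrBl sinB !sin_nat; ring.
by rewrite !mulrN sinN cosN hs; ring.
Qed.

(** Substitution of [cayley_arg t], done by exhibiting a primitive; [[-T, T]] is mapped into []-pi,
    pi[], whence a bound free of [T]. *)
Lemma bessel_cayley (T : R) : 0 < T ->
  (\int[lebesgue_measure]_(t in `[(- T)%R, T])
    ((hnorm (\sum_(n < N) ((1 + cayley t) * cayley t ^+ n) *: c n)%R ^+ 2)%R%:E) <=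
    (4 * pi * \sum_(n < N) hnorm (c n) ^+ 2)%R%:E)%E.
Proof.
move=> T0.
pose f (t : R) := 2 * (energy (cayley_arg t) * (2 / (1 + t ^+ 2))).
pose F (t : R) := 2 * energy_primitive (cayley_arg t).
have fE (t : R) : hnorm (\sum_(n < N) ((1 + cayley t) * cayley t ^+ n) *: c n) ^+ 2 = f t.
  under eq_bigr do rewrite -scalerA.
  rewrite -scaler_sumr hnormZ exprMn sqr_norm_1cayley hnorm_energy /f.
  by field; rewrite gt_eqF// ltr_pwDl ?sqr_ge0.
have darg (t : R) : is_derive t 1 (@cayley_arg R) (2 / (1 + t ^+ 2)).
  rewrite (_ : @cayley_arg R = 2 \*: atan); last first.
    by apply/funext => x; rewrite /cayley_arg -[LHS]mulr_natl.
  exact: (@is_deriveZ _ _ _ atan 2 t 1 _ (is_derive1_atan t)).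
have dF (t : R) : is_derive t 1 F (f t).
  have h := @is_derive1_comp _ energy_primitive (@cayley_arg R) t _ _
    (is_derive_energy_primitive _) (darg t).
  exact: (@is_deriveZ _ _ _ _ 2 t 1 _ h).
have cont (g : R -> R) (dg : R -> R) : (forall t : R, is_derive t 1 g (dg t)) -> continuous g.
  by move=> h x; apply/differentiable_continuous/derivable1_diffP; have [] := h x.
have cF : continuous F by exact: cont dF.
have cf : continuous f.
  move=> t; apply: cvgM; first exact: cvg_cst.
  apply: cvgM.
    apply: (@continuous_comp _ _ _ (@cayley_arg R) energy); first exact: (cont _ _ darg).
    by apply/differentiable_continuous/derivable1_diffP; exact: derivable_energy.
  apply: cvgM; first exact: cvg_cst.
  apply: cvgV; first by rewrite gt_eqF// ltr_pwDl ?sqr_ge0.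
  apply: cvgD; first exact: cvg_cst.
  exact: exprn_continuous.
under eq_integral do rewrite fE.
rewrite (@continuous_FTC2 _ f F)//.
- rewrite -EFinD lee_fin /F -mulrBr (_ : 4 * pi * _ = 2 * (2 * pi * \sum_(n < N) hnorm (c n) ^+ 2)); last by ring.
  rewrite ler_pM2l//; apply: energy_primitive_le.
  + have := atan_gtNpi2 (- T); rewrite /cayley_arg -mulr_natl; lra.
  + rewrite /cayley_arg lerMn2r/=; apply/ltW; apply: lt_atan; lra.
  + have := atan_ltpi2 T; rewrite /cayley_arg -mulr_natl; lra.
- lra.
- exact: continuous_subspaceT.
- split.
  + by move=> x _; have [] := dF x.
  + by apply: cvg_at_right_filter; exact: cF.
  + by apply: cvg_at_left_filter; exact: cF.
- by move=> x _; rewrite derive1E; exact: (@derive_val _ _ _ _ _ _ _ (dF x)).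
Qed.

End bessel_inequality.

(** * Continuity of inner products of vector families *)

Section locally_lipschitz.
Context (R : realType) (H : hilbertType R).
Implicit Types (f g : R -> H).

(** One endpoint stays at [s0], which is weaker than a Lipschitz condition near [s0]; it gives
    continuity and passes easily through the recursion. *)
Definition loc_lipschitz f := forall s0, exists C, forall s,
  `|s - s0| <= 1 -> hnorm (f s - f s0) <= C * `|s - s0|.

Lemma loc_lipschitz_cst x : loc_lipschitz (fun=> x).
Proof. by move=> s0; exists 0 => s _; rewrite subrr hnorm0 mul0r. Qed.

Lemma loc_lipschitzD f g :
  loc_lipschitz f -> loc_lipschitz g -> loc_lipschitz (fun s => f s + g s).
Proof.
move=> lf lg s0; have [C hC] := lf s0; have [D hD] := lg s0.
exists (C + D) => s hs; rewrite opprD addrACA (le_trans (hnormD _ _))//.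
by rewrite mulrDl lerD// ?hC ?hD.
Qed.

Lemma loc_lipschitzZ a f : loc_lipschitz f -> loc_lipschitz (fun s => a *: f s).
Proof.
move=> lf s0; have [C hC] := lf s0; exists (complex.Re `|a| * C) => s hs.
rewrite -scalerBr hnormZ -mulrA ler_wpM2l ?hC//.
by rewrite normc_def /= sqrtr_ge0.
Qed.

Lemma continuous_ip f g :
  loc_lipschitz f -> loc_lipschitz g -> continuous (fun s => ip (f s) (g s)).
Proof.
move=> lf lg s0; have [C hC] := lf s0; have [D hD] := lg s0.
(* The summand 1 makes [K] invertible. *)
pose K := `|C| * (hnorm (g s0) + `|D|) + hnorm (f s0) * `|D| + 1.
have K0 : 0 < K.
  by rewrite ltr_wpDl// addr_ge0// mulr_ge0 ?addr_ge0 ?hnorm_ge0.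
have lip s : `|s - s0| <= 1 ->
    `|ip (f s) (g s) - ip (f s0) (g s0)| <= K * `|s - s0|.
  move=> hs; have fs := hC s hs; have gs := hD s hs.
  have -> : ip (f s) (g s) - ip (f s0) (g s0) =
      ip (f s - f s0) (g s) + ip (f s0) (g s - g s0).
    by rewrite ipDl ipDr ipNl ipNr; ring.
  apply: le_trans (ler_normD _ _) _.
  have C1 : C * `|s - s0| <= `|C| * `|s - s0| by rewrite ler_wpM2r// ler_norm.
  have D1 : D * `|s - s0| <= `|D| * `|s - s0| by rewrite ler_wpM2r// ler_norm.
  have D2 : `|D| * `|s - s0| <= `|D| by rewrite ler_piMr.
  have gB : hnorm (g s) <= hnorm (g s0) + `|D|.
    rewrite -(subrK (g s0) (g s)) addrC (le_trans (hnormD _ _))// lerD2l.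
    exact: le_trans (le_trans gs D1) D2.
  have h1 : `|ip (f s - f s0) (g s)| <= (`|C| * `|s - s0|) * (hnorm (g s0) + `|D|).
    rewrite (le_trans (normr_ip _ _))// ler_pM ?hnorm_ge0//.
    exact: le_trans C1.
  have h2 : `|ip (f s0) (g s - g s0)| <= hnorm (f s0) * (`|D| * `|s - s0|).
    rewrite (le_trans (normr_ip _ _))// ler_wpM2l ?hnorm_ge0//.
    exact: le_trans D1.
  have : 0 <= `|s - s0| by [].
  by rewrite /K => ?; lra.
have sid : id s @[s --> s0] --> s0 by exact: cvg_id.
have near1 : \forall s \near s0, `|s0 - s| <= 1 by move/cvgrPdist_le : sid => /(_ _ ltr01).
apply/cvgrPdist_lt => eps eps0.
have near2 : \forall s \near s0, `|s0 - s| < K^-1 * eps.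
  by move/cvgrPdist_lt : sid; apply; rewrite mulr_gt0// invr_gt0.
near=> s; rewrite distrC; apply: (@le_lt_trans _ _ (K * `|s - s0|)).
  by apply: lip; rewrite distrC; near: s.
by rewrite -ltr_pdivlMl// distrC; near: s.
Unshelve. all: by end_near. Qed.

End locally_lipschitz.

(** * Joint measurability of the approximations in both couplings *)

Section measurability_in_couplings.
Context (R : realType) (H : hilbertType R).
Variables (A L V : {linear H -> H}).
Hypotheses (saA : self_adjoint A) (saL : self_adjoint L) (saV : self_adjoint V).
Hypothesis L0 : forall x, 0 <= ip (L x) x.
Variables (MA ML MV : R).
Hypotheses (bA : forall x, hnorm (A x) <= MA * hnorm x)
           (ML0 : 0 <= ML) (bL : forall x, hnorm (L x) <= ML * hnorm x)
           (bV : forall x, hnorm (V x) <= MV * hnorm x).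
Variables (c e : R).
Hypothesis e0 : 0 < e.
Variable y : H.

(** A linear map, so that it can replace [A] in the results above; [V] carries the coupling that is
    not averaged. *)
Definition coupled s : {linear H -> H} := A \+ s%:C \*: V.

Lemma coupledE s x : coupled s x = A x + s%:C *: V x.
Proof. by []. Qed.

Lemma self_adjoint_coupled s : self_adjoint (coupled s).
Proof.
move=> x z; rewrite !coupledE linearDl linearDr /= saA; congr (_ + _).
rewrite linearZl_LR linearZr_LR.
transitivity (s%:C * inner x (V z)); first by congr (_ * _); exact: saV.
by congr (_ * _); apply/eqP; rewrite eq_complex /= oppr0 !eqxx.
Qed.

Lemma hnorm_coupled s x : hnorm (coupled s x) <= (MA + `|s| * MV) * hnorm x.
Proof.
rewrite coupledE (le_trans (hnormD _ _))// mulrDl lerD// hnormZr -mulrA.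
by rewrite ler_wpM2l.
Qed.

Local Notation step s := (resolvent_step (coupled s) L c e).

Let stepE s x : dissipative (coupled s) L c e (step s x) = L x.
Proof.
exact: (resolvent_stepE (self_adjoint_coupled s) L0 (hnorm_coupled s) bL c e0).
Qed.

(** A resolvent identity: the operator at [s] sends the difference of the two steps to
    [L (v s - v s0) - (s - s0) V u0], and it is bounded below by [e]. *)
Lemma loc_lipschitz_step (v : R -> H) :
  loc_lipschitz v -> loc_lipschitz (fun s => step s (v s)).
Proof.
move=> lv s0; have [C hC] := lv s0.
exists ((ML * C + MV * hnorm (step s0 (v s0))) / e) => s hs.
rewrite mulrAC ler_pdivlMr// mulrC.
apply: le_trans (dissipative_ge (self_adjoint_coupled s) L0 c _ _) _.
have -> : dissipative (coupled s) L c e (step s (v s) - step s0 (v s0)) =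
   L (v s - v s0) - (s - s0)%:C *: V (step s0 (v s0)).
  set u := step s (v s); set u0 := step s0 (v s0).
  transitivity (dissipative (coupled s) L c e u - dissipative (coupled s0) L c e u0
      - (s - s0)%:C *: V u0); last by rewrite !stepE (linearB L).
  apply: ip_ext => z; rewrite /dissipative !coupledE !(linearB A) !(linearB L) !(linearB V).
  by rewrite !(ipDl, ipNl, ipZl, ip_Ni); ring.
rewrite (le_trans (hnormB _ _))// mulrDl; apply: lerD.
  by rewrite (le_trans (bL _))// -mulrA ler_wpM2l// hC.
by rewrite hnormZr mulrC ler_wpM2r// bV.
Qed.

Lemma loc_lipschitz_avg_y n : loc_lipschitz (fun s => avg_y (coupled s) L c e y n).
Proof.
elim: n => [|n IH]; first exact: loc_lipschitz_cst.
apply: loc_lipschitzD => //; do 2 apply: loc_lipschitzZ.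
exact: loc_lipschitz_step.
Qed.

Lemma loc_lipschitz_avg_u n : loc_lipschitz (fun s => avg_u (coupled s) L c e y n).
Proof. apply: loc_lipschitz_step; exact: loc_lipschitz_avg_y. Qed.

Let cmeasurable (f : R -> R[i]) :=
  measurable_fun setT (fun t => complex.Re (f t)) /\
  measurable_fun setT (fun t => complex.Im (f t)).

Let cmeasurable_cst a : cmeasurable (fun=> a).
Proof. by split; exact: measurable_cst. Qed.

Let cmeasurableM f g : cmeasurable f -> cmeasurable g ->
  cmeasurable (fun t => f t * g t).
Proof.
move=> [rf jf] [rg jg]; split.
  rewrite (_ : (fun _ => _) = (fun t => complex.Re (f t) * complex.Re (g t)
      - complex.Im (f t) * complex.Im (g t))).
    by apply: measurable_funB; exact: measurable_funM.
  by apply/funext => t; case: (f t); case: (g t).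
rewrite (_ : (fun _ => _) = (fun t => complex.Re (f t) * complex.Im (g t)
      + complex.Im (f t) * complex.Re (g t))).
  by apply: measurable_funD; exact: measurable_funM.
by apply/funext => t; case: (f t); case: (g t).
Qed.

Let cmeasurableX f n : cmeasurable f -> cmeasurable (fun t => f t ^+ n).
Proof.
move=> mf; elim: n => [|n IH]; first exact: cmeasurable_cst.
rewrite (_ : (fun _ => _) = (fun t => f t * f t ^+ n)); last first.
  by apply/funext => t; rewrite exprS.
exact: cmeasurableM.
Qed.

Let measurable_cayley_arg : measurable_fun setT (@cayley_arg R).
Proof.
apply: continuous_measurable_fun => t; rewrite /cayley_arg.
exact: (cvgMn (n := 2) (@continuous_atan R t)).
Qed.

Let cmeasurable_cayley : cmeasurable (@cayley R).
Proof.
split.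
  apply: measurableT_comp; last exact: measurable_cayley_arg.
  exact: continuous_measurable_fun (@continuous_cos R).
apply: measurableT_comp; first exact: oppr_measurable.
apply: measurableT_comp; last exact: measurable_cayley_arg.
exact: continuous_measurable_fun (@continuous_sin R).
Qed.

Let coef N n (t : R) : R[i] := (N - n)%:R%:C * ((1 + cayley t) * (- cayley t) ^+ n).

Let cmeasurable_coef N n : cmeasurable (coef N n).
Proof.
have m1 : cmeasurable (fun t => 1 + cayley t).
  have [h1 h2] := cmeasurable_cayley; split.
    by apply: measurable_funD.
  by rewrite (_ : (fun _ => _) = (fun t => complex.Im (cayley t)))//; apply/funext => t; rewrite /= add0r.
have m2 : cmeasurable (fun t => - cayley t).
  have [h1 h2] := cmeasurable_cayley; split.
    by apply: measurableT_comp h1; exact: oppr_measurable.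
  by apply: measurableT_comp h2; exact: oppr_measurable.
apply: cmeasurableM; first exact: cmeasurable_cst.
by apply: cmeasurableM => //; exact: cmeasurableX.
Qed.

Lemma ip_scale (a b : R[i]) (x z : H) : ip (a *: x) (b *: z) =
  (complex.Re a * complex.Re b + complex.Im a * complex.Im b) * ip x z +
  (complex.Re a * complex.Im b - complex.Im a * complex.Re b) * ip x ('i *: z).
Proof.
have ipr u v : ip u (b *: v) = complex.Re b * ip u v + complex.Im b * ip u ('i *: v).
  by rewrite ipC ipZc (ipC v) (ipC v) ip_Ni mulrN opprK.
rewrite ipZc scalerA (mulrC 'i) -scalerA !ipr scalerA -expr2 sqr_i scaleN1r ipNr.
by ring.
Qed.

(** The expanded square is a finite sum of products separating the variables: the coefficients
    depend measurably on [t] alone, the inner products continuously on [s] alone. *)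
Lemma measurable_avg_vec m : measurable_fun setT (fun ts : R * R =>
  hnorm (avg_vec (coupled ts.2) L c e y ts.1 m) ^+ 2).
Proof.
set N := (m ^ 2)%N.
rewrite (_ : (fun _ => _) = (fun ts : R * R => N%:R^-1 ^+ 2 *
  \sum_(i < N) \sum_(j < N)
   ((complex.Re (coef N i ts.1) * complex.Re (coef N j ts.1) +
     complex.Im (coef N i ts.1) * complex.Im (coef N j ts.1)) *
    ip (avg_u (coupled ts.2) L c e y i) (avg_u (coupled ts.2) L c e y j) +
    (complex.Re (coef N i ts.1) * complex.Im (coef N j ts.1) -
     complex.Im (coef N i ts.1) * complex.Re (coef N j ts.1)) *
    ip (avg_u (coupled ts.2) L c e y i) ('i *: avg_u (coupled ts.2) L c e y j)))); last first.
  apply/funext => -[t s] /=; rewrite /avg_vec /avg_sum hnormZr exprMn.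
  rewrite real_normK ?num_real// hnormE big_mkord ip_suml; congr (_ * _).
  apply: eq_bigr => i _; rewrite ip_sumr; apply: eq_bigr => j _.
  by rewrite /avg_term !scalerA ip_scale.
have mc (f : R -> R) : measurable_fun setT f ->
    measurable_fun setT (fun ts : R * R => f ts.1).
  by move=> mf; apply: measurableT_comp mf _; exact: measurable_fst.
have ms (f : R -> R) : continuous f ->
    measurable_fun setT (fun ts : R * R => f ts.2).
  move=> cf; apply: (measurableT_comp (continuous_measurable_fun cf)).
  exact: measurable_snd.
apply: measurable_funM; first exact: measurable_cst.
apply: measurable_sum => i; apply: measurable_sum => j.
have [r1 i1] := cmeasurable_coef N i; have [r2 i2] := cmeasurable_coef N j.
apply: measurable_funD; apply: measurable_funM.
- by apply: measurable_funD; apply: measurable_funM;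
    [exact: (mc _ r1)|exact: (mc _ r2)|exact: (mc _ i1)|exact: (mc _ i2)].
- apply: (ms (fun s => ip (avg_u (coupled s) L c e y i) (avg_u (coupled s) L c e y j))).
  by apply: continuous_ip; exact: loc_lipschitz_avg_u.
- by apply: measurable_funB; apply: measurable_funM;
    [exact: (mc _ r1)|exact: (mc _ i2)|exact: (mc _ i1)|exact: (mc _ r2)].
- apply: (ms (fun s => ip (avg_u (coupled s) L c e y i) ('i *: avg_u (coupled s) L c e y j))).
  apply: continuous_ip; first exact: loc_lipschitz_avg_u.
  by apply: loc_lipschitzZ; exact: loc_lipschitz_avg_u.
Qed.

End measurability_in_couplings.

(** * Bounds and measurability of lower limits *)

Section limn_einf_bounds.
Context (R : realType).
Implicit Types (u : nat -> \bar R) (a : \bar R).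
Local Open Scope ereal_scope.

Lemma limn_einf_ge u a (N : nat) :
  (forall n, (N <= n)%N -> a <= u n) -> a <= limn_einf u.
Proof.
move=> h; rewrite limn_einf_lim; apply: lime_ge; first exact: is_cvg_einfs.
exists N => // n /= Nn; apply: le_ereal_inf_tmp => _ [k /= nk <-].
by apply: h; exact: leq_trans nk.
Qed.

Lemma limn_einf_le u a :
  (forall n, exists2 m, (n <= m)%N & u m <= a) -> limn_einf u <= a.
Proof.
move=> h; rewrite limn_einf_lim; apply: lime_le; first exact: is_cvg_einfs.
apply: nearW => n; have [m nm um] := h n; apply: le_trans um.
by apply: ereal_inf_lbound; exists m.
Qed.

Lemma measurable_limn_einf d (T : measurableType d) (D : set T)
    (f : nat -> T -> \bar R) :
  (forall n, measurable_fun D (f n)) ->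
  measurable_fun D (fun x => limn_einf (f ^~ x)).
Proof.
move=> mf.
rewrite (_ : (fun _ => _) = (fun x => - limn_esup (fun n => - f n x))).
  apply: measurableT_comp; first exact: oppe_measurable.
  by apply: measurable_fun_limn_esup => n; exact: measurableT_comp.
apply/funext => x; rewrite -[X in X = _]oppeK; congr (- _).
exact/esym/(limn_esupN (f ^~ x)).
Qed.

End limn_einf_bounds.

(** * Spectral averaging over one interval *)

Section interval_estimates.
Context (R : realType) (H : hilbertType R).
Variables (A L V : {linear H -> H}).
Hypotheses (saA : self_adjoint A) (saL : self_adjoint L) (saV : self_adjoint V).
Hypothesis L0 : forall x, 0 <= ip (L x) x.
Variables (MA ML MV : R).
Hypotheses (bA : forall x, hnorm (A x) <= MA * hnorm x)
           (ML0 : 0 <= ML) (bL : forall x, hnorm (L x) <= ML * hnorm x)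
           (bV : forall x, hnorm (V x) <= MV * hnorm x).
Variable y : H.

Local Notation leb := (@lebesgue_measure R).
Local Notation total s t := (coupled (coupled A V s) L t).

(** [E D] commutes with the full operator, and on its range the operator minus [c] has norm at most
    [e]; the term [i e] accounts for the second [e]. *)
Let pvm_near (E : pvm H) s t (D : set (measurableTypeR R)) (c e : R) q :
  spectral_pvm (total s t) E -> measurable D -> 0 <= e ->
  (forall l, D l -> c - e <= l <= c + e) ->
  hnorm (E D (L y)) <=
    2 * e * hnorm q + hnorm (L y - perturbed (coupled A V s) L c e t q).
Proof.
move=> sE mD e0 De.
set P := perturbed _ _ _ _ _ _.
have saT : self_adjoint (total s t).
  by apply: self_adjoint_coupled => //; exact: self_adjoint_coupled.
have PE : E D P = (total s t (E D q) - c%:C *: E D q) - 'i *: (e%:C *: E D q).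
  rewrite (pvm_commute saT sE q mD) /P /perturbed.
  by rewrite !(linearB (E D)) !(linear_scale (E D)).
have -> : E D (L y) = E D P + E D (L y - P).
  by rewrite -(linearD (E D)) (addrC P) subrK.
apply: le_trans (hnormD _ _) _; apply: lerD; last exact: hnorm_pvm.
rewrite PE; apply: le_trans (hnormB _ _) _; rewrite hnorm_i hnormZr ger0_norm//.
have h1 := spectral_near saT sE q mD e0 De.
have h2 : e * hnorm (E D q) <= e * hnorm q by rewrite ler_wpM2l// hnorm_pvm.
lra.
Qed.

(* For ]a, b[ = ]c - e, c + e[ the limit inferior of |2 e q_m|^2, where q_m are
   the Cesaro approximations of (A + s V + t L - c - i e)^-1 (L y). *)
Definition interval_bound (ab ts : R * R) : \bar R :=
  if ab.1 < ab.2 then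
    limn_einf (fun m => ((hnorm ((ab.2 - ab.1)%:C *: avg_vec (coupled A V ts.2) L
      ((ab.1 + ab.2) / 2) ((ab.2 - ab.1) / 2) y ts.1 m.+1) ^+ 2)%:E))
  else 0%E.

Lemma interval_bound_ge0 ab ts : (0 <= interval_bound ab ts)%E.
Proof.
rewrite /interval_bound; case: ifP => // _.
by apply: (@limn_einf_ge _ _ _ 0%N) => n _; rewrite lee_fin sqr_ge0.
Qed.

Let measurable_term ab m : ab.1 < ab.2 -> measurable_fun setT (fun ts : R * R =>
  ((hnorm ((ab.2 - ab.1)%:C *: avg_vec (coupled A V ts.2) L
      ((ab.1 + ab.2) / 2) ((ab.2 - ab.1) / 2) y ts.1 m.+1) ^+ 2)%:E)).
Proof.
move=> ab12; apply/measurable_EFinP.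
have e0 : 0 < (ab.2 - ab.1) / 2 by rewrite divr_gt0// subr_gt0.
rewrite (_ : (fun _ => _) = (fun ts : R * R => `|ab.2 - ab.1| ^+ 2 *
    hnorm (avg_vec (coupled A V ts.2) L
      ((ab.1 + ab.2) / 2) ((ab.2 - ab.1) / 2) y ts.1 m.+1) ^+ 2)); last first.
  by apply/funext => ts; rewrite hnormZr exprMn.
apply: measurable_funM; first exact: measurable_cst.
exact: (measurable_avg_vec saA saV L0 bA ML0 bL bV ((ab.1 + ab.2) / 2) e0 y m.+1).
Qed.

Lemma measurable_interval_bound ab : measurable_fun setT (interval_bound ab).
Proof.
rewrite /interval_bound; case: (ltP ab.1 ab.2) => ab12; last exact: measurable_cst.
by apply: measurable_limn_einf => m; exact: measurable_term.
Qed.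

Let measurable_slice (f : R * R -> \bar R) s (D : set R) :
  measurable_fun setT f -> measurable_fun D (fun t => f (t, s)).
Proof.
move=> mf; apply: measurable_funTS; apply: (measurableT_comp mf).
by apply: measurable_fun_pair => //; exact: measurable_cst.
Qed.

(** Fatou reduces to a single Cesaro mean, where [bessel_cayley] and [avg_u_sum] give
    [4 pi (2 e)^2 / (4 e) = 2 pi (2 e)] times [ip (L y) y]. *)
Lemma integral_interval_bound ab s (T : R) : 0 < T ->
  (\int[leb]_(t in `[(- T)%R, T]) interval_bound ab (t, s) <=
    (2 * pi * ip (L y) y)%:E * wlength idfun `]ab.1, ab.2[)%E.
Proof.
move=> T0; rewrite /interval_bound /=; case: (ltP ab.1 ab.2) => ab12; last first.
  by rewrite integral0 set_itv_ge ?wlength0 ?mule0// bnd_simp -leNgt.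
set e := (ab.2 - ab.1) / 2; set c := (ab.1 + ab.2) / 2.
have e0 : 0 < e by rewrite divr_gt0// subr_gt0.
have abe : ab.2 - ab.1 = 2 * e by rewrite /e mulrC divfK.
apply: le_trans (fatou _ _ _ _) _ => //.
- by move=> m; exact: (measurable_slice s (measurable_term m ab12)).
- by move=> m t _; rewrite lee_fin sqr_ge0.
apply: limn_einf_le => n; exists n => //.
set N := (n.+1 ^ 2)%N.
pose u := avg_u (coupled A V s) L c e y.
(* The Cesaro weights, at most 1, and the signs from [- w] are absorbed into the coefficients. *)
pose k i : R := 2 * e * (N%:R^-1 * (N - i)%:R).
pose cc i : H := ((k i)%:C * (-1) ^+ i) *: u i.
rewrite wlength_itv /= lte_fin ab12 -EFinD -EFinM abe.
under eq_integral => t _.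
  rewrite (_ : _ *: _ = \sum_(i < N) ((1 + cayley t) * cayley t ^+ i) *: cc i); last first.
    rewrite /avg_vec -/N /avg_sum big_mkord scaler_sumr scaler_sumr.
    apply: eq_bigr => i _; rewrite /avg_term /cc /u !scalerA; congr (_ *: _).
    by rewrite /k !rmorphM /= [(- cayley t) ^+ i]exprNn; ring.
  over.
apply: le_trans (bessel_cayley cc N T0) _; rewrite lee_fin.
have kk (i : 'I_N) : hnorm (cc i) ^+ 2 <= (2 * e) ^+ 2 * ip (u i) (u i).
  rewrite /cc -scalerA hnormZr exprMn hnormZ normrX normrN1 expr1n mul1r hnormE.
  rewrite ler_wpM2r ?ip_ge0// real_normK ?num_real// /k exprMn.
  rewrite ler_piMr ?sqr_ge0// expr_le1//.
  have N0 : 0 < N%:R :> R by rewrite ltr0n expn_gt0.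
  by rewrite mulrC ler_pdivrMr// mul1r ler_nat leq_subr.
have saT := self_adjoint_coupled saA saV s.
have h := avg_u_sum saT saL L0 (hnorm_coupled bA bV s) bL c e0 y N.
have h2 : \sum_(i < N) hnorm (cc i) ^+ 2 <= (2 * e) ^+ 2 * (ip (L y) y / (4 * e)).
  apply: le_trans (ler_sum _ (fun i _ => kk i)) _; rewrite -mulr_sumr.
  by rewrite ler_wpM2l ?sqr_ge0// -(big_mkord xpredT (fun i => ip (u i) (u i))).
have pi0 : 0 < 4 * pi :> R by rewrite mulr_gt0 ?pi_gt0.
apply: le_trans (_ : _ <= 4 * pi * ((2 * e) ^+ 2 * (ip (L y) y / (4 * e)))) _.
  by rewrite ler_pM2l.
rewrite le_eqVlt; apply/orP; left; apply/eqP; field; rewrite gt_eqF//.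
Qed.

(** Combining [pvm_near] and [avg_error], [a <= b_m + C / (m + 1)] for every [m]. The bound holds at
    each point, so nothing is asked of [E] as a function of the couplings. *)
Lemma scalar_measure_interval_bound (E : pvm H) ab s t :
  spectral_pvm (total s t) E ->
  (scalar_measure E (L y) `]ab.1, ab.2[%classic <= interval_bound ab (t, s))%E.
Proof.
move=> sE; rewrite /interval_bound; case: (ltP ab.1 ab.2) => ab12; last first.
  by rewrite set_itv_ge ?measure0// bnd_simp -leNgt.
rewrite [X in (X <= _)%E]scalar_measure_hnorm//=.
set D := [set` _]; set e := (ab.2 - ab.1) / 2; set c := (ab.1 + ab.2) / 2.
have e0 : 0 < e by rewrite divr_gt0// subr_gt0.
have abe : ab.2 - ab.1 = 2 * e by rewrite /e mulrC divfK.
have saT := self_adjoint_coupled saA saV s.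
have [C hC] := avg_error saT saL L0 ML0 (hnorm_coupled bA bV s) bL c e0 y t.
set a := hnorm _.
have De l : D l -> c - e <= l <= c + e.
  by rewrite /D /= in_itv /= /c /e => /andP[? ?]; apply/andP; split; lra.
have am m : a <= 2 * e * hnorm (avg_vec (coupled A V s) L c e y t m.+1) + C / m.+1%:R.
  apply: le_trans (pvm_near (avg_vec (coupled A V s) L c e y t m.+1) sE _ (ltW e0) De) _.
    exact: measurable_itv.
  by rewrite lerD2l; exact: hC.
apply/lee_addgt0Pr => d d0; rewrite -leeBlDr//.
have a0 : 0 <= a by exact: hnorm_ge0.
(* Beyond this index [2 a C / (m + 1) <= d], which controls [a^2 - b^2 = (a - b) (a + b)] when
   [b <= a]. *)
apply: (@limn_einf_ge _ _ _ (Num.truncn (2 * a * `|C| / d)).+1) => m hm.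
rewrite -EFinB lee_fin abe hnormZr ger0_norm; last by rewrite mulr_ge0 ?ltW.
have {}am := am m.
set b := 2 * e * _ in am *.
have b0 : 0 <= b by rewrite /b mulr_ge0 ?hnorm_ge0// mulr_ge0// ltW.
have m0 : 0 < m.+1%:R :> R by rewrite ltr0n.
have h1 : 2 * a * `|C| < m.+1%:R * d.
  rewrite -ltr_pdivrMr//; apply: lt_le_trans (truncnS_gt _) _.
  by rewrite ler_nat (leq_trans hm).
have h2 : 2 * a * (C / m.+1%:R) <= d.
  rewrite mulrA ler_pdivrMr// [leRHS]mulrC; apply: le_trans (ltW h1).
  by rewrite ler_wpM2l ?mulr_ge0// ler_norm.
case: (leP b a) => [ba|/ltW lt_ab].
  have : (a - b) * (a + b) <= (C / m.+1%:R) * (2 * a).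
    apply: ler_pM; [lra|lra| |lra].
    by rewrite lerBlDl; exact: am.
  move=> h3; have h4 : (a - b) * (a + b) = a ^+ 2 - b ^+ 2 by ring.
  rewrite h4 [leRHS]mulrC in h3.
  by have := le_trans h3 h2; lra.
apply: (@le_trans _ _ (a ^+ 2)); first by rewrite gerBl ltW.
by rewrite lerXn2r ?nnegrE.
Qed.

End interval_estimates.

(** * Interval covers of null sets *)

Section null_sets.
Context (R : realType).
Local Notation leb := (@lebesgue_measure R).

Lemma null_set_cover (B : set R) (d : R) : leb B = 0%E -> 0 < d ->
  exists ab : nat -> R * R, B `<=` \bigcup_j `](ab j).1, (ab j).2[%classic /\
    (\sum_(0 <= j <oo) wlength idfun `](ab j).1, (ab j).2[%classic <= d%:E)%E.
Proof.
move=> B0 d0.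
have : (ereal_inf [set \sum_(0 <= k <oo) wlength idfun (F k) | F in @open_itv_cover _ R B] < d%:E)%E.
  by rewrite -outer_measure_open_itv_cover [ltLHS]B0 lte_fin.
move=> /ereal_inf_lt[_ [F [itvF BF] <-] Fd].
have /choice[ab abF] : forall j, exists ab : R * R, F j = `]ab.1, ab.2[%classic.
  by move=> j; have [ab ->] := itvF j; exists ab.
exists ab; split; first by move=> x /BF[j _ Fx]; exists j => //; rewrite -abF.
by rewrite (eq_eseriesr (g := fun j => wlength idfun (F j))) ?ltW// => j _; rewrite abF.
Qed.

End null_sets.

(** * The exceptional set of couplings for one vector *)

Section averaging_null_set.
Context (R : realType) (H : hilbertType R).
Variables (A L V : {linear H -> H}).
Hypotheses (saA : self_adjoint A) (saL : self_adjoint L) (saV : self_adjoint V).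
Hypothesis L0 : forall x, 0 <= ip (L x) x.
Hypotheses (bA : bounded_op A) (bL : bounded_op L) (bV : bounded_op V).
Local Notation leb := (@lebesgue_measure R).

(** Covers of [B] of total length [1 / (k + 1)] give dominating functions [G k] whose integrals over
    a bounded window tend to 0; by Fatou their lower limit vanishes almost everywhere. *)
Lemma spectral_averaging (B : set R) (y : H) : measurable B -> leb B = 0%E ->
  exists N : set (R * R), [/\ measurable N, forall s, leb (ysection N s) = 0%E &
    forall t s, ~ N (t, s) -> forall E : pvm H,
      spectral_pvm (fun x => A x + s%:C *: V x + t%:C *: L x) E -> E B (L y) = 0].
Proof.
move=> mB B0.
have [MA _ hA] := bounded_opP bA.
have [ML /ltW ML0 hL] := bounded_opP bL.
have [MV _ hV] := bounded_opP bV.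
have /choice[ab abP] : forall k : nat, exists ab : nat -> R * R,
    B `<=` \bigcup_j `](ab j).1, (ab j).2[%classic /\
    (\sum_(0 <= j <oo) wlength idfun `](ab j).1, (ab j).2[%classic <= (k.+1%:R^-1)%:E)%E.
  by move=> k; apply: null_set_cover => //; rewrite invr_gt0 ltr0n.
pose g k j := interval_bound A L V y (ab k j).
have mg k j : measurable_fun setT (g k j).
  exact: (measurable_interval_bound saA saV L0 hA ML0 hL hV).
have g0 k j ts : (0 <= g k j ts)%E by exact: interval_bound_ge0.
pose G k ts := (\sum_(0 <= j <oo) g k j ts)%E.
have mG k : measurable_fun setT (G k) by apply: ge0_emeasurable_sum.
have G0 k ts : (0 <= G k ts)%E by apply: nneseries_ge0.
pose Ginf ts := limn_einf (G ^~ ts).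
have mGinf : measurable_fun setT Ginf by exact: measurable_limn_einf.
have Ginf0 ts : (0 <= Ginf ts)%E by apply: (@limn_einf_ge _ _ _ 0%N) => n _.
have mslice (f : R * R -> \bar R) s D : measurable_fun setT f ->
    measurable_fun D (fun t => f (t, s)).
  move=> mf; apply: measurable_funTS; apply: (measurableT_comp mf).
  by apply: measurable_fun_pair => //; exact: measurable_cst.
(* Defined through [Ginf] alone, the set is measurable and serves every [E]. *)
pose N := [set ts | Ginf ts != 0%E].
have mN : measurable N.
  by have := emeasurable_neq measurableT mGinf 0%E; rewrite setTI.
exists N; split => //.
- move=> s; apply: measure_negligible; first exact: measurable_ysection.
  pose I n : set (measurableTypeR R) := `[(- n.+1%:R)%R, n.+1%:R]%classic.
  pose Z n := [set t | ~ (I n t -> Ginf (t, s) = 0%E)].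
  have sub : ysection N s `<=` \bigcup_n Z n.
    move=> t /ysectionP /= /eqP Nt; exists (Num.truncn `|t|) => //= h.
    apply: Nt; apply: h; rewrite /I /= in_itv /= -ler_norml ltW//.
    exact: truncnS_gt.
  suff [M [mM M0 ZM]] : leb.-negligible (\bigcup_n Z n).
    by exists M; split => //; exact: subset_trans ZM.
  apply: negligible_bigcup => n.
  have T0 : 0 < n.+1%:R :> R by rewrite ltr0n.
  set C := 2 * pi * ip (L y) y.
  have C0 : 0 <= C by rewrite !mulr_ge0 ?pi_ge0 ?L0.
  have mI : measurable (I n) by exact: measurable_itv.
  have intG k : (\int[leb]_(t in I n) G k (t, s) <=
      (C * k.+1%:R^-1)%:E)%E.
    rewrite integral_nneseries//; last by move=> j; exact: mslice.
    apply: (@le_trans _ _ (\sum_(0 <= j <oo) C%:E *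
        wlength idfun `](ab k j).1, (ab k j).2[%classic)%E).
      apply: lee_nneseries => [j _ _|j _]; first by apply: integral_ge0 => t _.
      exact: (integral_interval_bound saA saL saV L0 hA ML0 hL hV).
    rewrite nneseriesZl; last by move=> j _; exact: wlength_ge0.
    by rewrite [leRHS]EFinM lee_wpmul2l ?lee_fin//; have [] := abP k.
  have int0 : (\int[leb]_(t in I n) `|Ginf (t, s)| = 0)%E.
    under eq_integral do rewrite gee0_abs//.
    apply/eqP; rewrite eq_le integral_ge0 ?andbT; last by move=> t _.
    have mGk : forall j : nat, measurable_fun (I n) (fun t => G j (t, s)).
      by move=> j; exact: mslice.
    have Gk0 (j : nat) r : I n r -> (0 <= G j (r, s))%E by move=> _; exact: G0.
    apply: le_trans (fatou leb mI mGk Gk0) _.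
    apply/lee_addgt0Pr => d d0; rewrite add0e; apply: limn_einf_le => p.
    exists (maxn p (Num.truncn (C / d))); first exact: leq_maxl.
    apply: le_trans (intG _) _; rewrite lee_fin.
    rewrite ler_pdivrMr ?ltr0n// -ler_pdivrMl// mulrC.
    apply/ltW/(lt_le_trans (truncnS_gt _)).
    by rewrite ler_nat ltnS leq_maxr.
  have mGs : measurable_fun (I n) (fun t => Ginf (t, s)) by exact: mslice.
  by have /(ae_eq_integral_abs leb mI mGs) := int0.
- move=> t s /negP; rewrite negbK => /eqP G00 E sE.
  apply: hnorm0_eq0; apply/eqP; rewrite -sqrf_eq0 -eqe -scalar_measure_hnorm//.
  rewrite eq_le measure_ge0 andbT.
  apply: (@le_trans _ _ (Ginf (t, s))); last by rewrite G00.
  apply: (@limn_einf_ge _ _ _ 0%N) => k _; have [Bsub _] := abP k.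
  apply: (@le_trans _ _ (\sum_(0 <= j <oo)
      scalar_measure E (L y) `](ab k j).1, (ab k j).2[%classic)%E).
    by apply: measure_sigma_subadditive => // j; exact: measurable_itv.
  apply: lee_nneseries => [j _ _|j _]; first exact: measure_ge0.
  exact: (scalar_measure_interval_bound saA saL saV L0 hA ML0 hL hV).
Qed.

End averaging_null_set.

(** * The parts of [K] as nonnegative bounded operators *)

Section positive_and_negative_parts.
Context (R : realType) (H : hilbertType R).
Variables (K : {linear H -> H}) (EK : pvm H).
Hypotheses (bK : bounded_op K) (saK : self_adjoint K) (sK : spectral_pvm K EK).

Definition positive_op : {linear H -> H} := K \o EK `]0, +oo[%classic.
Definition negative_op : {linear H -> H} := \- (K \o EK `]-oo, 0[%classic).

Let pvm_restr_sa (B : set (measurableTypeR R)) :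
  measurable B -> self_adjoint (K \o EK B).
Proof.
move=> mB x y /=; rewrite saK (pvm_self_adjoint EK mB).
by rewrite (pvm_commute saK sK y mB).
Qed.

Let ip_restr (B : set (measurableTypeR R)) x : measurable B ->
  ip (K (EK B x)) x = ip (K (EK B x)) (EK B x).
Proof.
move=> mB; rewrite -{1}(pvm_idem EK mB x) (pvm_commute saK sK _ mB).
by rewrite (self_adjoint_ip (pvm_self_adjoint EK mB)).
Qed.

Let mpos : measurable (`]0, +oo[%classic : set (measurableTypeR R)).
Proof. exact: measurable_itv. Qed.

Let mneg : measurable (`]-oo, 0[%classic : set (measurableTypeR R)).
Proof. exact: measurable_itv. Qed.

Lemma self_adjoint_positive_op : self_adjoint positive_op.
Proof. exact: pvm_restr_sa. Qed.

Lemma self_adjoint_negative_op : self_adjoint negative_op.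
Proof.
move=> x y; rewrite [LHS]linearNl [RHS]linearN; congr (- _).
exact: pvm_restr_sa.
Qed.

Lemma positive_op_ge0 x : 0 <= ip (positive_op x) x.
Proof.
rewrite /= ip_restr//.
have := @spectral_ge _ _ _ _ sK x _ 0 mpos; rewrite mul0r; apply.
by move=> l /=; rewrite in_itv /= andbT => /ltW.
Qed.

Lemma negative_op_ge0 x : 0 <= ip (negative_op x) x.
Proof.
rewrite /= ipNl ip_restr// oppr_ge0.
have := @spectral_le _ _ _ _ sK x _ 0 mneg; rewrite mul0r; apply.
by move=> l /=; rewrite in_itv /= => /ltW.
Qed.

Let bounded_restr (B : set (measurableTypeR R)) M : measurable B -> 0 < M ->
  (forall x, hnorm (K x) <= M * hnorm x) ->
  forall x, hnorm (K (EK B x)) <= M * hnorm x.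
Proof.
move=> mB M0 hM x; apply: le_trans (hM _) _.
by rewrite ler_pM2l// hnorm_pvm.
Qed.

Lemma bounded_positive_op : bounded_op positive_op.
Proof.
have [M M0 hM] := bounded_opP bK.
by apply: (@bounded_op_hnorm _ _ _ M); exact: bounded_restr.
Qed.

Lemma bounded_negative_op : bounded_op negative_op.
Proof.
have [M M0 hM] := bounded_opP bK.
apply: (@bounded_op_hnorm _ _ _ M) => x; rewrite /= hnormN.
exact: bounded_restr.
Qed.

(** The line splits at 0, and [K] vanishes on the range of [EK [set 0]] by [spectral_near] with
    radius 0. *)
Lemma positive_negative_op x : K x = positive_op x - negative_op x.
Proof.
rewrite /= opprK -(linearD K); set u := EK `]0, +oo[%classic x.
set v := EK `]-oo, 0[%classic x.
have E0 : K (EK [set 0] x) = 0.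
  apply: hnorm0_eq0; apply/eqP; rewrite eq_le hnorm_ge0 andbT.
  have m0 : measurable ([set 0] : set (measurableTypeR R)) by exact: measurable_set1.
  have D0 (l : R) : [set 0] l -> 0 - 0 <= l <= 0 + 0.
    by move=> ->; rewrite subr0 addr0 lexx.
  have := spectral_near saK sK x m0 (lexx 0) D0.
  by rewrite mul0r (_ : 0%:C = 0)// scale0r subr0.
have -> : K x = K (u + EK (~` `]0, +oo[%classic) x) by rewrite -pvm_setC.
rewrite (pvm_setC EK (EK (~` `]0, +oo[%classic) x) mneg).
have mposC : measurable (~` `]0, +oo[%classic : set (measurableTypeR R)).
  exact: measurableC.
rewrite -!pvm_setI//; last exact: measurableC.
rewrite (_ : _ `&` _ = `]-oo, 0[%classic); last first.
  apply/seteqP; split => l /=; rewrite !in_itv /= andbT; first by case.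
  by move=> l0; split => //; apply/negP; rewrite -leNgt ltW.
rewrite (_ : ~` _ `&` _ = [set 0]); last first.
  apply/seteqP; split => l /=; rewrite !in_itv /= andbT.
    by move=> [/negP + /negP]; rewrite -!leNgt => ? ?; apply/eqP; rewrite eq_le; apply/andP.
  by move=> ->; rewrite !ltxx.
by rewrite addrA [LHS](linearD K) E0 addr0.
Qed.

End positive_and_negative_parts.

(** * Planar null sets from null sections *)

Section product_null_sets.
Context (R : realType).
Local Notation leb := (@lebesgue_measure R).

(** The product measure integrates the other sections; uniqueness identifies it with the iterated
    integral in the reverse order. *)
Lemma product_null_ysection (N : set (R * R)) : measurable N ->
  (forall s, leb (ysection N s) = 0%E) -> (leb \x leb)%E N = 0%E.
Proof.
move=> mN N0.
rewrite (@product_measure_unique _ _ _ _ _ leb leb (leb \x^ leb)%E)//.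
  by rewrite /product_measure2 /=; apply: integral0_eq => s _ /=.
by move=> B C mB mC; exact: product_measure2E.
Qed.

Lemma product_null_swap (N : set (R * R)) : measurable N ->
  (forall s, leb (ysection N s) = 0%E) ->
  measurable [set ts : R * R | N (ts.2, ts.1)] /\
  (leb \x leb)%E [set ts | N (ts.2, ts.1)] = 0%E.
Proof.
move=> mN N0; split.
  by rewrite -[X in measurable X]setTI; apply: measurable_swap.
rewrite /product_measure1 /=; apply: integral0_eq => t _ /=.
rewrite -[RHS](N0 t); congr (leb _).
Qed.

End product_null_sets.

(** * From a countable dense set to the whole space, and the theorem *)

Lemma dense_kernel (R : realType) (H : hilbertType R) (T : {linear H -> H})
    (D : set H) : bounded_op T -> dense D -> (forall x, D x -> T x = 0) ->
  forall x, T x = 0.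
Proof.
move=> /bounded_opP[M M0 hM] dD TD x; apply: hnorm0_eq0; apply/eqP.
rewrite eq_le hnorm_ge0 andbT leNgt; apply/negP => Tx.
have e0 : 0 < (hnorm (T x) / M)%:C by rewrite ltcR divr_gt0.
have [y [xy Dy]] := dD (ball x (hnorm (T x) / M)%:C)
  (ex_intro _ x (ballxx x e0)) (ball_open x _).
move: xy; rewrite -ball_normE /= normE ltcR ltr_pdivlMr// mulrC ltNge => /negP; apply.
by apply: le_trans (hM _); rewrite (linearB T) (TD y Dy) subr0.
Qed.

Theorem theorem1p3 (R : realType) (H : hilbertType R) (sepH : separable H)
  (A K : {linear H -> H})
  (bA : bounded_op A) (saA : self_adjoint A)
  (bK : bounded_op K) (saK : self_adjoint K)
  (EK : pvm H) (hEK : spectral_pvm K EK)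
  (sigma : {finite_measure set (measurableTypeR R) -> \bar R})
  (sing : mutually_singular sigma (@lebesgue_measure R))
  (cyc : cyclic_for A (range K)) :
  {ae (@lebesgue_measure R \x @lebesgue_measure R)%E, forall t : R * R,
    forall mu : {measure set (measurableTypeR R) -> \bar R},
      is_spectral_measure
        (fun x : H => A x + t.1%:C *: positive_part K EK x
                          + t.2%:C *: negative_part K EK x) mu ->
      mutually_singular mu sigma}.
Proof.
have [N0 [mN0 sN0 lN0]] := sing.
(* A Lebesgue null set carrying [sigma]; the goal is [E B = 0] for almost all couplings. *)
set B := ~` N0 in lN0.
have mB : measurable B by exact: measurableC.
pose Kp := positive_op K EK; pose Kn := negative_op K EK.
have saKp : self_adjoint Kp by exact: self_adjoint_positive_op.
have saKn : self_adjoint Kn by exact: self_adjoint_negative_op.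
have bKp : bounded_op Kp by exact: bounded_positive_op.
have bKn : bounded_op Kn by exact: bounded_negative_op.
have Kp0 : forall x, 0 <= ip (Kp x) x by exact: positive_op_ge0.
have Kn0 : forall x, 0 <= ip (Kn x) x by exact: negative_op_ge0.
have [D [/countable_injP[code code_inj] dD]] := sepH.
pose d n := xget 0 [set x | D x /\ code x = n].
have dE x : D x -> d (code x) = x.
  move=> Dx; rewrite /d; case: xgetP => [z _ [Dz /code_inj]|/(_ x)].
    by apply; rewrite inE.
  by move=> /(_ (conj Dx erefl)).
have /choice[Np NpP] := fun n => spectral_averaging saA saKp saKn Kp0 bA bKp bKn (d n) mB lN0.
(* The averaged coupling comes first, so here the coordinates are exchanged and [Nn] must be swapped
   before the union. *)
have /choice[Nn NnP] := fun n => spectral_averaging saA saKn saKp Kn0 bA bKn bKp (d n) mB lN0.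
have negp : (@lebesgue_measure R \x @lebesgue_measure R)%E.-negligible (\bigcup_n Np n).
  apply: negligible_bigcup => n; have [mN null _] := NpP n.
  by exists (Np n); split => //; exact: product_null_ysection.
have negn : (@lebesgue_measure R \x @lebesgue_measure R)%E.-negligible
    (\bigcup_n [set ts : R * R | Nn n (ts.2, ts.1)]).
  apply: negligible_bigcup => n; have [mN null _] := NnP n.
  have [mS S0] := product_null_swap mN null.
  by exists [set ts : R * R | Nn n (ts.2, ts.1)]; split; [exact: mS|exact: S0|].
have [M [mM M0 bad]] := negligibleU negp negn.
exists M; split => // -[t s]; apply: contra_notP => Mts.
have good n : ~ Np n (t, s) /\ ~ Nn n (s, t).
  by split => h; apply: Mts; apply: bad; [left|right]; exists n.
move=> mu [E [x [sE _ muE]]].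
pose T : {linear H -> H} := coupled (coupled A Kp t) Kn s.
have sT : spectral_pvm T E by exact: sE.
have saT : self_adjoint T.
  by apply: self_adjoint_coupled => //; exact: self_adjoint_coupled.
have bE : bounded_op (E B).
  by apply: (@bounded_op_hnorm _ _ _ 1) => z; rewrite mul1r hnorm_pvm.
have bcomp (L : {linear H -> H}) : bounded_op L -> bounded_op (E B \o L).
  move=> /bounded_opP[C _ hC]; apply: (@bounded_op_hnorm _ _ _ C) => z /=.
  by apply: le_trans (hC z); exact: hnorm_pvm.
have EKp z : E B (Kp z) = 0.
  apply: (@dense_kernel _ _ (E B \o Kp) D) => [|//|y Dy]; first exact: bcomp.
  have [_ _ h] := NpP (code y); rewrite /= -(dE y Dy).
  apply: (h t s) => [|]; first by have [] := good (code y).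
  by move: sT; congr spectral_pvm; apply/funext => u; rewrite /T /= addrAC.
have EKn z : E B (Kn z) = 0.
  apply: (@dense_kernel _ _ (E B \o Kn) D) => [|//|y Dy]; first exact: bcomp.
  have [_ _ h] := NnP (code y); rewrite /= -(dE y Dy).
  by apply: (h s t) => //; have [] := good (code y).
have EB0 z : E B z = 0.
  have : [set: H] z by [].
  rewrite -cyc => inM; apply: (inM [set u | E B u = 0]).
  split; last first.
    move=> _ [u _ <-]; rewrite /= (positive_negative_op saK hEK u).
    by rewrite (linearB (E B)) /= [X in X - _]EKp [X in _ - X]EKn subr0.
  split.
  - have cE : continuous (E B) by exact: bounded_linear_continuous.
    apply: (closed_comp (f := E B) (D := [set 0])) => //.
    exact: accessible_closed_set1 (hausdorff_accessible (@norm_hausdorff _ _)) _.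
  - exact: linear0.
  - by move=> a u v /= Eu Ev; rewrite linearP /= Eu Ev scaler0 addr0.
  - move=> u /= Eu.
    (* [E B] commutes with [T] rather than with [A], but the difference lies in the ranges of [Kp]
       and [Kn], which [E B] kills. *)
    have -> : A u = T u - t%:C *: Kp u - s%:C *: Kn u.
      by apply: ip_ext => v; rewrite /T !coupledE !(ipDl, ipNl); ring.
    rewrite !(linearB (E B)) !(linear_scale (E B)) EKp EKn !scaler0 !subr0.
    by rewrite -(pvm_commute saT sT u mB) Eu linear0.
exists B; split => //; last by rewrite setCK.
by rewrite muE// scalar_measureE// EB0 ip0l.
Qed.
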